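(* There exist a real number $\epsilon>0$ and a positive integer $d$ such that, if $Y=Y(L_1,\ldots,L_d)$ where $L_1,\ldots,L_d$ are chosen independently and uniformly at random from the set $\mathcal{L}_n$ of all Latin squares of order $n$, then $$\lim_{n\rightarrow\infty}\Pr\left[h_1(Y)>\epsilon\right]=1 .$$
   Context: Let $\mathbb{S}_n$ be the symmetric group on $[n]=\{1,\ldots,n\}$. A Latin square of order $n$ is an $n$-tuple $L=(\pi_1,\ldots,\pi_n)\in\mathbb{S}_n^n$ such that $\pi_i\pi_j^{-1}$ is fixed point free for all $1\le i<j\le n$. $\mathcal{L}_n$ denotes the set of all Latin squares of order $n$, with the uniform probability measure. Let $V_1=\{a_i\}_{i=1}^n$, $V_2=\{b_i\}_{i=1}^n$, $V_3=\{c_i\}_{i=1}^n$ be three disjoint sets. The complete 3-partite complex $T_n$ is the simplicial complex on $V=V_1\cup V_2\cup V_3$ consisting of all $\sigma\subset V$ with $|\sigma\cap V_i|\le 1$ for $i=1,2,3$; $T_n^{(1)}$ is its 1-skeleton. For $L=(\pi_1,\ldots,\pi_n)\in\mathcal{L}_n$, $Y(L)$ is the subcomplex of $T_n$ containing $T_n^{(1)}$ whose 2-simplices are exactly $[a_i,b_j,c_{\pi_i(j)}]$, $1\le i,j\le n$. For $(L_1,\ldots,L_d)\in\mathcal{L}_n^d$ let $Y(L_1,\ldots,L_d)=\bigcup_{k=1}^d Y(L_k)$. For a simplicial complex $X$, $X(k)$ is the set of its $k$-dimensional faces and $C^k(X;\mathbb{F}_2)$ is the space of $\mathbb{F}_2$-valued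 functions on $X(k)$. The coboundary map $d_k:C^k(X;\mathbb{F}_2)\to C^{k+1}(X;\mathbb{F}_2)$ is $d_k\phi(v_0,\ldots,v_{k+1})=\sum_{i=0}^{k+1}\phi(v_0,\ldots,v_{i-1},v_{i+1},\ldots,v_{k+1})$. Let $B^1(X;\mathbb{F}_2)=d_0(C^0(X;\mathbb{F}_2))$. For a cochain $\phi$ let $\|\phi\|=|\mathrm{supp}(\phi)|$, and for $\phi\in C^1(X;\mathbb{F}_2)$ let $\|[\phi]\|=\min\{|\mathrm{supp}(\phi+d_0\psi)|:\psi\in C^0(X;\mathbb{F}_2)\}$. The first coboundary expansion constant is $$h_1(X)=\min\left\{\frac{\|d_1\phi\|}{\|[\phi]\|}:\phi\in C^1(X;\mathbb{F}_2)-B^1(X;\mathbb{F}_2)\right\}.$$ *)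

(* Defs.v *)
From HB Require Import structures.
From mathcomp Require Import all_boot all_order all_fingroup all_algebra.
From mathcomp Require Import reals constructive_ereal.

Set Implicit Arguments.
Unset Strict Implicit.
Unset Printing Implicit Defensive.

Import Order.TTheory GRing.Theory Num.Theory.

Local Open Scope ring_scope.

(* The empty simplex is allowed; it is a face of dimension -1. *)
Record scomplex (V : finType) := SComplex {
  simplices :> {set {set V}};
  simplicesP : forall s t : {set V},
    s \in simplices -> t \subset s -> t \in simplices
}.

Definition faces (V : finType) (X : scomplex V) (k : nat) : {set {set V}} :=
  [set s in simplices X | #|s| == k.+1].

Notation cochain X k := {ffun {s : {set _} | s \in faces X k} -> 'F_2}.

Section Complexes.
Variable V : finType.
Implicit Type X : scomplex V.

Lemma skeleton_subproof X k (s t : {set V}) :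
  s \in [set s in simplices X | #|s| <= k.+1]%N -> t \subset s ->
  t \in [set s in simplices X | #|s| <= k.+1]%N.
Proof.
rewrite !inE => /andP[sX sk] ts; rewrite (simplicesP sX ts) /=.
exact: leq_trans (subset_leq_card ts) sk.
Qed.

Definition skeleton X (k : nat) : scomplex V :=
  SComplex (@skeleton_subproof X k).

Lemma cunion_subproof (I : finType) (X : I -> scomplex V) (s t : {set V}) :
  s \in (\bigcup_i simplices (X i))%SET -> t \subset s ->
  t \in (\bigcup_i simplices (X i))%SET.
Proof.
case/bigcupP=> i iI sX ts; apply/bigcupP; exists i => //.
exact: simplicesP sX ts.
Qed.

Definition cunion (I : finType) (X : I -> scomplex V) : scomplex V :=
  SComplex (@cunion_subproof I X).

(* Value of a cochain at a set of vertices, 0 if this is not a k-face; the    *)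
(* latter case never occurs in [cobound], since X is closed under subsets.    *)
Definition cochain_at X k (phi : cochain X k) (s : {set V}) : 'F_2 :=
  if insub s is Some u then phi u else 0.

Definition cobound X k (phi : cochain X k) : cochain X k.+1 :=
  [ffun s : {s | s \in faces X k.+1} =>
    \sum_(v in sval s) cochain_at phi (sval s :\ v)].

Definition B1 X : {set cochain X 1} :=
  [set cobound psi | psi : cochain X 0].

Definition cnorm X k (phi : cochain X k) : nat :=
  #|[set s | phi s != 0]|.

Definition class_norm X (phi : cochain X 1) : nat :=
  let shifted (psi : cochain X 0) := cnorm (phi + cobound psi) in
  shifted [arg min_(psi < (0 : cochain X 0)) shifted psi].

(* The minimum is over a finite set; it is +oo when C^1 = B^1, and the        *)
(* denominator is positive since phi is not in B^1.                           *)
Definition h1 (R : realType) X : \bar R :=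
  \big[Order.min/+oo%E]_(phi : cochain X 1 | phi \notin B1 X)
    ((cnorm (cobound phi))%:R / (class_norm phi)%:R)%:E.

End Complexes.

Section LatinComplex.
Variable n : nat.

Definition vertex : finType := ('I_n + 'I_n + 'I_n)%type.
Definition va (i : 'I_n) : vertex := inl (inl i).
Definition vb (i : 'I_n) : vertex := inl (inr i).
Definition vc (i : 'I_n) : vertex := inr i.

Definition V1 : {set vertex} := [set va i | i : 'I_n].
Definition V2 : {set vertex} := [set vb i | i : 'I_n].
Definition V3 : {set vertex} := [set vc i | i : 'I_n].

Definition tripartite_set : {set {set vertex}} :=
  [set s : {set vertex} |
    [&& #|s :&: V1| <= 1, #|s :&: V2| <= 1 & #|s :&: V3| <= 1]%N].

Lemma tripartite_subproof (s t : {set vertex}) :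
  s \in tripartite_set -> t \subset s -> t \in tripartite_set.
Proof.
rewrite !inE => /and3P[h1 h2 h3] ts; apply/and3P.
split; [apply: leq_trans h1|apply: leq_trans h2|apply: leq_trans h3];
  exact: subset_leq_card (setSI _ ts).
Qed.

Definition Tcomplex : scomplex vertex := SComplex tripartite_subproof.

(* pi_i pi_j^-1 is a composition of functions, pi_j^-1 applied first; the    *)
(* product of permutations in MathComp composes in the other order.          *)
Definition is_latin (L : {ffun 'I_n -> {perm 'I_n}}) : bool :=
  [forall i : 'I_n, forall j : 'I_n, (i < j)%N ==>
    [forall x : 'I_n, L i ((L j)^-1%g x) != x]].

Definition latin : finType := {L : {ffun 'I_n -> {perm 'I_n}} | is_latin L}.

Definition triangle (L : latin) (i j : 'I_n) : {set vertex} :=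
  [set va i; vb j; vc (val L i j)].

Definition Yset (L : latin) : {set {set vertex}} :=
  simplices (skeleton Tcomplex 1) :|: [set triangle L i j | i : 'I_n, j : 'I_n].

Lemma triangle_T (L : latin) i j : triangle L i j \in simplices Tcomplex.
Proof.
have sub1 (A : {set vertex}) x : A \subset [set x] -> (#|A| <= 1)%N.
  by move/subset_leq_card; rewrite cards1.
rewrite inE /=; apply/and3P; split;
  [apply: (sub1 _ (va i))|apply: (sub1 _ (vb j))|apply: (sub1 _ (vc (val L i j)))];
  apply/subsetP => x /setIP[xt /imsetP[y _ ex]]; move: xt; rewrite ex !inE;
  by case/orP => [/orP[]|] //; rewrite ?eqxx.
Qed.

Lemma Y_subproof (L : latin) (s t : {set vertex}) :
  s \in Yset L -> t \subset s -> t \in Yset L.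
Proof.
case/setUP => sY ts; apply/setUP; first by left; apply: simplicesP sY ts.
have [->|nts] := eqVneq t s; first by right.
left; case/imset2P: sY => i j _ _ es.
have sT : s \in simplices Tcomplex by rewrite es triangle_T.
apply/setIdP; split; first exact: simplicesP sT ts.
have lts : (#|t| < #|s|)%N by rewrite proper_card // properEneq nts.
rewrite -ltnS; apply: leq_trans lts _; rewrite es /triangle.
apply: leq_trans (leq_card_setU _ _) _; rewrite cards1 addn1 ltnS.
by rewrite cards2; case: (_ != _).
Qed.

Definition Y (L : latin) : scomplex vertex := SComplex (@Y_subproof L).

Definition Yunion (d : nat) (Ls : {ffun 'I_d -> latin}) : scomplex vertex :=
  cunion (fun k : 'I_d => Y (Ls k)).

End LatinComplex.

(* Probability of the event E for (t_1, ..., t_d) chosen independently and    *)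
(* uniformly from S, i.e. for the d-fold product of the uniform distribution. *)
Definition Pr_unif (R : realType) (S : finType) (d : nat)
    (E : pred {ffun 'I_d -> S}) : R :=
  \sum_(t : {ffun 'I_d -> S} | E t) \prod_(k < d) (#|S|%:R)^-1.

(* Main.v *)
(** Two counting estimates show that a random Latin square avoids a dense set of
    triples with probability only exp(-c n^2).  Completing a square row by row
    and bounding permanents from below by Gurvits' capacity argument, there are
    at least (n/e^2)^(n^2) squares.  Revealing the cells in random order, at most
    ((1+o(1)) n/e^2)^(n^2) exp(-c n^2) of them meet in few cells a given set of
    a constant proportion of all the triples.

    Let phi be a 1-cochain of minimal weight in its class.  If its weight is at
    least a constant times n^2, its coboundary on the complete tripartite complex
    has positive density, so for large d a union bound over the 2^(3n^2) cochains
    applies.  Otherwise one uses the links: the link of a vertex of Y is a union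
    of d independent uniform permutations, in which, with high probability, small
    vertex sets span few edges and sets of at most half of the vertices span at
    most 9/10 of the incident edges.  By minimality at most half of the edges at
    each vertex lie in phi, and since most edges of phi have an end of small
    degree, few triangles contain two or more edges of phi. *)

Require Import Defs.
From HB Require Import structures.
From mathcomp Require Import all_classical all_reals all_analysis.
From mathcomp Require Import all_boot all_order all_fingroup all_algebra all_field.
From mathcomp Require Import ring lra zify.

Set Implicit Arguments.
Unset Strict Implicit.
Unset Printing Implicit Defensive.

Import Order.TTheory GRing.Theory Num.Theory.
Import numFieldNormedType.Exports.

Local Open Scope ring_scope.


(** * Permanents of regular bipartite graphs *)

(** The two counts of Latin squares must agree up to a factor exp(e n^2) with e arbitrarily small,
    since any fixed loss in the exponent could swallow the gain exp(-c n^2). This is why permanents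
    are bounded by the sharp n!/n^n and why the upper bound keeps the exact base n/e^2.

    The cells of a single square are not independent. What symmetry does give is that each link
    permutation is exactly uniform. Different links are dependent, so they are combined only by a
    union bound over the 3n vertices, for which each link may fail with probability O(n^-2).

    The constants could become circular: [delta] separates small degrees from large ones and must
    satisfy 8 * 2^d * delta^(q-5) <= 1, the rate [c'] of the deviation bound depends on [delta], and
    d must be large in terms of [c']. Fixing the ratio d = 200 q breaks the circle: one value of
    [delta] serves every q >= 10, so q can be chosen last. *)

Lemma coef0_prod_linear (R : comNzRingType) (I : Type) (r : seq I) (u w : I -> R) :
  (\prod_(i <- r) ((u i)%:P + w i *: 'X))`_0 = \prod_(i <- r) u i.
Proof.
elim: r => [|i r IH]; first by rewrite !big_nil coef1.
by rewrite !big_cons coef0M IH coefD coefC coefZ coefX mulr0 addr0.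
Qed.

Lemma coef_linearM (R : comNzRingType) (u w : R) (p : {poly R}) k :
  ((u%:P + w *: 'X) * p)`_k.+1 = u * p`_k.+1 + w * p`_k.
Proof. by rewrite mulrDl coefD coefCM -scalerAl coefZ coefXM. Qed.

Lemma coef1_prod_linear (R : comNzRingType) (I : eqType) (r : seq I) (u w : I -> R) :
  uniq r ->
  (\prod_(i <- r) ((u i)%:P + w i *: 'X))`_1 =
  \sum_(i <- r) w i * \prod_(j <- r | j != i) u j.
Proof.
elim: r => [_|i r IH /= /andP[ir ur]]; first by rewrite !big_nil coef1.
rewrite !big_cons eqxx /= coef_linearM coef0_prod_linear IH // addrC.
congr (_ + _).
  congr (_ * _); rewrite [RHS]big_seq_cond [LHS]big_seq; apply: eq_bigl => j.
  by case: (boolP (j \in r)) => //= jr; apply/esym; apply: contraNneq ir => <-.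
rewrite mulr_sumr !big_seq; apply: eq_bigr => j jr.
have nij : i != j by apply: contraNneq ir => ->.
by rewrite big_cons nij mulrCA.
Qed.

Lemma coef_top_prod_linear (R : comNzRingType) (I : Type) (r : seq I) (u w : I -> R) k :
  (size r <= k)%N ->
  (\prod_(i <- r) ((u i)%:P + w i *: 'X))`_k =
  if k == size r then \prod_(i <- r) w i else 0.
Proof.
elim: r k => [k|i r IH [|k]] //=.
  by rewrite !big_nil coef1; case: eqP.
rewrite ltnS => rk; rewrite !big_cons coef_linearM !IH 1?leqW // eqSS.
by rewrite gtn_eqF ?ltnS // mulr0 add0r; case: eqP; rewrite ?mulr0.
Qed.

Section Closed.
Variable C : numClosedFieldType.

(** Roots are replaced by z = -1/root, so that the coefficient of X divided by the constant term is
    the sum of the z. Both the half-plane argument and the AM-GM bound below concern that sum. *)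
Lemma factor_inv_roots (f : {poly C}) : f`_0 != 0 ->
  exists2 r : seq C, f = f`_0 *: \prod_(z <- r) (1%:P + z *: 'X) &
    size r = (size f).-1 /\ (forall z, z \in r -> z != 0 /\ root f (- z^-1)).
Proof.
move=> f0; have [s fE] := closed_field_poly_normal f.
have fn0 : f != 0 by apply: contraNneq f0 => ->; rewrite coef0.
have c0 : lead_coef f != 0 by rewrite lead_coef_eq0.
have sroot z : z \in s -> root f z.
  by move=> zs; rewrite fE rootZ // root_prod_XsubC.
have s0 z : z \in s -> z != 0.
  move=> zs; apply: contraNneq f0 => z0; move: (sroot _ zs).
  by rewrite z0 rootE horner_coef0.
have sE : \prod_(z <- s) ('X - z%:P) =
   (\prod_(z <- s) (- z)) *: \prod_(z <- [seq - z^-1 | z <- s]) (1%:P + z *: 'X).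
  have : all (fun z => z != 0) s by apply/allP.
  elim: (s) => [_|z t IH /= /andP[z0 t0]]; first by rewrite !big_nil scale1r.
  rewrite /= !big_cons IH //.
  have -> : 'X - z%:P = (- z) *: (1%:P + (- z^-1) *: 'X).
    by rewrite scalerDr scalerA mulrNN mulfV // scale1r -mul_polyC mulr1 polyCN addrC.
  by rewrite -scalerAl -scalerAr scalerA.
exists [seq - z^-1 | z <- s].
  rewrite {1}fE sE scalerA; congr (_ *: _).
  by rewrite [in RHS]fE sE scalerA coefZ coef0_prod_linear big1_eq mulr1.
split.
  by rewrite size_map fE size_scale // size_prod_XsubC.
move=> _ /mapP[z zs ->]; rewrite invrN invrK opprK oppr_eq0 invr_eq0 s0 //.
by split => //; apply: sroot.
Qed.

(** All roots have negative real part, so every z = -1/root has positive real part, and so has the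
    sum f_1/f_0 of the z. This is how stability passes to a partial derivative at 0. *)
Lemma coef1_neq0_halfplane (f : {poly C}) : (1 < size f)%N ->
  (forall t, 0 <= 'Re t -> ~~ root f t) -> f`_1 != 0.
Proof.
move=> sf rf.
have f0 : f`_0 != 0.
  by have := rf 0; rewrite rootE horner_coef0 raddf0; apply.
have [r fE [sr rr]] := factor_inv_roots f0.
rewrite fE coefZ mulf_neq0 //.
have -> : (\prod_(z <- r) (1%:P + z *: 'X))`_1 = \sum_(z <- r) z :> C.
  elim: (r) => [|z t IH]; first by rewrite !big_nil coef1.
  by rewrite !big_cons coef_linearM IH coef0_prod_linear big1_eq mulr1 mul1r addrC.
have rpos z : z \in r -> 0 < 'Re z.
  move=> /rr[z0 zr]; have zR : 'Re z \is Num.real by apply: Creal_Re.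
  case: (real_ltP (real0 _) zR) => // zle.
  have := rf (- z^-1); rewrite zr raddfN /= ReV oppr_ge0 => /(_ _)/negP.
  move=> []; rewrite // pmulr_lle0 // invr_gt0 exprn_gt0 // normr_gt0 //.
suff: 0 < 'Re (\sum_(z <- r) z).
  by move=> H; apply: contraTneq H => ->; rewrite raddf0 ltxx.
rewrite raddf_sum /= big_seq; case: r sr rpos {fE rr} => [/= s1|z t _ rpos].
  by move: sf; case: (size f) s1 => [|[]].
rewrite -big_seq big_cons ltr_wpDr ?rpos ?mem_head // big_seq sumr_ge0 // => i it.
by rewrite ltW // rpos // inE it orbT.
Qed.

(** With negative real roots, f(t)/f_0 is a product of N factors 1 + z t with z > 0, and AM-GM
    replaces each factor by their mean 1 + t f_1/(f_0 N). *)
Lemma horner_le_AGM (f : {poly C}) N t : size f = N.+1 -> 0 < f`_0 -> 0 <= t ->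
  (forall z, root f z -> z < 0) ->
  0 <= f`_1 /\ f.[t] <= f`_0 * (1 + t * (f`_1 / f`_0) / N%:R) ^+ N.
Proof.
move=> sf f0 t0 rf; have fn0 : f`_0 != 0 by rewrite gt_eqF.
have [r fE [sr rr]] := factor_inv_roots fn0.
have rpos z : z \in r -> 0 < z.
  by move=> /rr[z0 /rf]; rewrite oppr_lt0 invr_gt0.
have f1 : f`_1 = f`_0 * \sum_(z <- r) z.
  rewrite {1}fE coefZ; congr (_ * _).
  elim: (r) => [|z s IH]; first by rewrite !big_nil coef1.
  by rewrite !big_cons coef_linearM IH coef0_prod_linear big1_eq mulr1 mul1r addrC.
have rN : size r = N by rewrite sr sf.
split.
  rewrite f1; apply: mulr_ge0; first exact: ltW.
  by rewrite big_seq sumr_ge0 // => z /rpos /ltW.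
rewrite {1}fE hornerZ ler_pM2l // f1 [f`_0 * (\sum_(z <- r) z)]mulrC mulfK //.
rewrite horner_prod -rN (big_tnth _ _ r) [in leRHS](big_tnth _ _ r).
have [r0|r0] := posnP (size r).
  rewrite [X in _ ^+ X]r0 expr0 big1 // => i; suff: false by [].
  by have := ltn_ord i; rewrite [X in (_ < X)%N]r0 ltn0.
have := @leif_AGM _ _ [set: 'I_(size r)] (fun i => 1 + t * tnth (in_tuple r) i).
rewrite cardsT card_ord => /(_ _)[|H _].
  move=> i _; rewrite addr_ge0 // mulr_ge0 // ltW // rpos // mem_tnth //.
apply: le_trans (le_trans H _).
  rewrite le_eqVlt; apply/orP; left; apply/eqP.
  by apply: eq_big => i; rewrite ?inE // => _; rewrite !hornerE mulrC.
under eq_bigl do rewrite inE.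
rewrite big_split /= -mulr_sumr sumr_const card_ord mulrDl.
by rewrite divff ?pnatr_eq0 ?gt_eqF.
Qed.
End Closed.

Definition update (T : Type) (x : nat -> T) (m : nat) (t : T) : nat -> T :=
  fun l => if l == m then t else x l.

(** * Gurvits' polynomials and their stability *)

Section MixedPermanent.
Variables (C : numClosedFieldType) (n : nat) (a : 'I_n -> nat -> C).

(* Gurvits' polynomials: [k!] times the derivative of
   [\prod_i \sum_l a i l * x l] once in each variable [x l] with [k <= l],
   evaluated with these variables set to 0. *)
Definition mixed_per (k : nat) (x : nat -> C) : C :=
  \sum_(s : 'S_n) \prod_(j < n)
    (if (j < k)%N then \sum_(l < k) a (s j) l * x l else a (s j) j).

Lemma mixed_per_full (x : nat -> C) :
  mixed_per n x = n`!%:R * \prod_(i < n) \sum_(l < n) a i l * x l.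
Proof.
rewrite /mixed_per (eq_bigr (fun=> \prod_(i < n) \sum_(l < n) a i l * x l)).
  by rewrite sumr_const card_Sn mulr_natl.
move=> s _; rewrite [RHS](reindex_perm s) /=; apply: eq_bigr => j _.
by rewrite ltn_ord.
Qed.

Lemma mixed_per_scale k (c : C) (x : nat -> C) :
  mixed_per k (fun l => c * x l) =
  (\prod_(j < n) (if (j < k)%N then c else 1)) * mixed_per k x.
Proof.
rewrite /mixed_per mulr_sumr; apply: eq_bigr => s _.
rewrite -big_split /=; apply: eq_bigr => j _; case: ifP => _; last by rewrite mul1r.
by rewrite mulr_sumr; apply: eq_bigr => l _; rewrite mulrCA.
Qed.

(* [slice m x] is [mixed_per m.+1] as a polynomial in its last variable. *)
Definition slice_factor (m : nat) (x : nat -> C) (s : 'S_n) (j : 'I_n) : {poly C} :=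
  (if (j < m.+1)%N then \sum_(l < m) a (s j) l * x l else a (s j) j)%:P +
  (if (j < m.+1)%N then a (s j) m else 0) *: 'X.

Definition slice (m : nat) (x : nat -> C) : {poly C} :=
  \sum_(s : 'S_n) \prod_(j < n) slice_factor m x s j.

Lemma horner_slice m x t : (slice m x).[t] = mixed_per m.+1 (update x m t).
Proof.
rewrite /slice horner_sum; apply: eq_bigr => s _.
rewrite horner_prod; apply: eq_bigr => j _; rewrite /slice_factor !hornerE.
case: ifP => _; last by rewrite mul0r addr0.
rewrite big_ord_recr /= /update eqxx; congr (_ + _).
by apply: eq_bigr => l _; rewrite ltn_eqF.
Qed.

(** The X comes from one factor j0 <= m. Composing with the transposition of j0 and m moves this
    factor to position m, where it becomes a fixed factor of [mixed_per m]; hence the m + 1 choices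
    of j0 contribute equally. *)
Lemma coef1_slice m x : (m < n)%N -> (slice m x)`_1 = m.+1%:R * mixed_per m x.
Proof.
move=> mn; rewrite /slice coef_sum.
under eq_bigr do rewrite coef1_prod_linear ?index_enum_uniq //.
rewrite exchange_big /= (bigID (fun j : 'I_n => (j < m.+1)%N)) /= [X in _ + X]big1 ?addr0; last first.
  by move=> j /negbTE jm; rewrite big1 // => s _; rewrite jm mul0r.
transitivity (\sum_(j < n | (j < m.+1)%N) mixed_per m x); last first.
  by rewrite (big_ord_narrow mn) sumr_const card_ord mulr_natl.
apply: eq_bigr => j0 j0m; pose mo := Ordinal mn.
pose tp := tperm j0 mo.
have tpm j : (tp j < m.+1)%N = (j < m.+1)%N.
  rewrite /tp; case: tpermP => [->|->|//] /=; last by rewrite j0m ltnSn.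
  by rewrite j0m ltnSn.
rewrite [LHS](reindex_inj (@mulgI _ tp)) /mixed_per; apply: eq_bigr => s _.
rewrite j0m permM /tp tpermL [RHS](bigD1 mo) //= ltnn; congr (_ * _).
rewrite (reindex_perm tp) /=; apply: eq_big => j.
  by rewrite -(inj_eq (@perm_inj _ tp) j mo) /tp tpermR.
move=> jn; have -> : (tp * s)%g (tp j) = s j by rewrite permM tpermK.
rewrite tpm.
have jm : j != mo by apply: contraNneq jn => ->; rewrite /tp tpermR.
have -> : (j < m.+1)%N = (j < m)%N.
  by rewrite ltnS leq_eqVlt; move: jm; rewrite -val_eqE /= => /negbTE ->.
case: (ltnP j m) => // mj; rewrite tpermD //; last by rewrite eq_sym.
  by apply: contraNneq jm => j0j; rewrite -val_eqE /= eqn_leq mj -j0j -ltnS j0m.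
Qed.

Hypothesis a_gt0 : forall i l, 0 < a i l.

Lemma size_slice m x : (m < n)%N -> size (slice m x) = m.+2.
Proof.
move=> mn; pose A := enum [pred j : 'I_n | (j < m.+1)%N].
have sA : size A = m.+1.
  by rewrite -cardE -sum1_card (big_ord_narrow mn) sum1_card card_ord.
have coefE k : (m < k)%N -> (slice m x)`_k =
    if k == m.+1 then \sum_(s : 'S_n) (\prod_(j < n | ~~ (j < m.+1)%N) a (s j) j) *
      \prod_(j <- A) a (s j) m else 0.
  move=> mk; rewrite /slice coef_sum.
  transitivity (\sum_(s : 'S_n) (\prod_(j < n | ~~ (j < m.+1)%N) a (s j) j) *
     (if k == m.+1 then \prod_(j <- A) a (s j) m else 0)).
    apply: eq_bigr => s _; rewrite (bigID (fun j : 'I_n => (j < m.+1)%N)) /= mulrC.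
    have -> : \prod_(j < n | ~~ (j < m.+1)%N) slice_factor m x s j =
              (\prod_(j < n | ~~ (j < m.+1)%N) a (s j) j)%:P.
      rewrite rmorph_prod; apply: eq_bigr => j /negbTE jm.
      by rewrite /slice_factor jm scale0r addr0.
    rewrite coefCM; congr (_ * _).
    rewrite -sA -(@coef_top_prod_linear _ _ _ (fun j => \sum_(l < m) a (s j) l * x l)) ?sA //.
    rewrite /A [in RHS]big_enum /=; congr (polyseq _)`_k.
    apply: eq_big => [j|j]; rewrite ?inE //.
    by move=> jm; rewrite /slice_factor jm.
  by case: eqP => // _; rewrite big1 // => s _; rewrite mulr0.
apply/eqP; rewrite eqn_leq; apply/andP; split.
  apply/leq_sizeP => k km; rewrite coefE ?gtn_eqF //; exact: ltnW.
rewrite ltnNge; apply/negP => /leq_sizeP/(_ m.+1 (leqnn _))/eqP.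
rewrite coefE // eqxx; apply/negP; rewrite gt_eqF //.
have pos (s : 'S_n) : 0 < (\prod_(j < n | ~~ (j < m.+1)%N) a (s j) j) * \prod_(j <- A) a (s j) m.
  by rewrite mulr_gt0 // prodr_gt0.
rewrite (bigD1 1%g) //= ltr_wpDr // sumr_ge0 // => s _; exact: ltW.
Qed.

Lemma Re_pmull (c z : C) : 0 < c -> 'Re (c * z) = c * 'Re z.
Proof. by move=> c0; rewrite -ReMl // gtr0_real. Qed.

(** Downward induction on m. At m = n there is a product of linear forms with positive coefficients,
    each taking a value of positive real part. In a step, the induction hypothesis says that the
    polynomial in the last variable has no root in the closed right half-plane, so its coefficient
    of X, a multiple of [mixed_per m x], is nonzero. *)
Lemma mixed_per_stable m (x : nat -> C) : (m <= n)%N ->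
  (forall l, (l < m)%N -> 0 <= 'Re (x l)) -> (exists2 l, (l < m)%N & 0 < 'Re (x l)) ->
  mixed_per m x != 0.
Proof.
move=> mn; rewrite -(subKn mn); move: (leq_subr m n).
elim: (n - m)%N x => [x _|d IH x dn] x0 [l0 l0m xl0].
  rewrite subn0 in x0 l0m *; rewrite mixed_per_full mulf_neq0 ?pnatr_eq0 -?lt0n ?fact_gt0 //.
  rewrite prodf_seq_neq0; apply/allP => i _ /=.
  have : 0 < 'Re (\sum_(l < n) a i l * x l).
    rewrite raddf_sum /= (bigD1 (Ordinal l0m)) //= Re_pmull // ltr_wpDr //.
      by apply: sumr_ge0 => l _; rewrite Re_pmull // mulr_ge0 ?x0 // ltW.
    by rewrite mulr_gt0.
  by apply: contraTneq => ->; rewrite raddf0 ltxx.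
have mn' : (n - d.+1 < n)%N by rewrite ltn_subrL (leq_trans _ dn).
have mE : (n - d.+1).+1 = (n - d)%N by rewrite subnSK.
have := @coef1_neq0_halfplane _ (slice (n - d.+1) x).
rewrite size_slice // coef1_slice // mulf_eq0 negb_or => /(_ isT) H.
suff /H/andP[_ ] : forall t, 0 <= 'Re t -> ~~ root (slice (n - d.+1) x) t by [].
move=> t t0; rewrite rootE horner_slice mE; apply: IH; first exact: ltnW.
  move=> l ll; rewrite /update; case: eqP => // /eqP lm; apply: x0.
  by rewrite ltn_neqAle lm -ltnS mE.
exists l0; first by rewrite -mE ltnW.
by rewrite /update ltn_eqF.
Qed.

End MixedPermanent.

Section MixedPermanent.
Variables (C : numClosedFieldType) (n : nat) (a : 'I_n -> nat -> C).
Hypothesis a_gt0 : forall i l, 0 < a i l.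

Lemma mixed_per_gt0 k (x : nat -> C) : (forall l, (l < k)%N -> 0 <= x l) ->
  (exists2 l, (l < k)%N & 0 < x l) -> 0 < mixed_per a k x.
Proof.
move=> x0 [l0 l0k xl0].
have pos (s : 'S_n) : 0 < \prod_(j < n)
    (if (j < k)%N then \sum_(l < k) a (s j) l * x l else a (s j) j).
  apply: prodr_gt0 => j _; case: ifP => // _.
  rewrite (bigD1 (Ordinal l0k)) //= ltr_wpDr ?mulr_gt0 // sumr_ge0 // => l _.
  by rewrite mulr_ge0 ?x0 ?ltn_ord // ltW.
by rewrite /mixed_per (bigD1 1%g) //= ltr_wpDr // sumr_ge0 // => s _; apply: ltW.
Qed.

(** Homogeneity and stability exclude every root off the negative axis: w = |z| + conj z has half
    the argument of conj z, so multiplying by w keeps the positive variables in the right half-plane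
    and brings z into it as well. *)
Lemma root_slice_lt0 m (x : nat -> C) z : (0 < m < n)%N ->
  (forall l, 0 < x l) -> root (slice a m x) z -> z < 0.
Proof.
move=> /andP[m0 mn] x0; rewrite rootE horner_slice => /eqP z_root.
have z0 : z != 0.
  apply/eqP => z0; move: z_root; rewrite z0; apply/eqP; rewrite gt_eqF //.
  apply: mixed_per_gt0 => [l _|]; first by rewrite /update; case: eqP => // _; apply: ltW.
  by exists 0%N => //; rewrite /update ltn_eqF.
have real_conj : 'Re z^* = 'Re z by rewrite Re_conj.
rewrite lt_neqAle z0 /=; case: (boolP (z <= 0)) => // zle.
(* Rotating all the variables by a common [w] keeps the zero. *)
pose w := `|z| + z^*.
have Rw : 0 < 'Re w.
  rewrite /w raddfD /= real_conj (Creal_ReP _ _) ?normr_real //.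
  have := leif_Re_Creal (- z); rewrite normrN raddfN /= oppr_ge0 (negbTE zle).
  by move/lt_leif; rewrite ltrNl -subr_gt0 opprK addrC.
suff : mixed_per a m.+1 (fun l => w * update x m z l) != 0.
  by rewrite mixed_per_scale z_root mulr0 eqxx.
apply: mixed_per_stable => // [l lm|].
  rewrite /update; case: eqP => _; last first.
    by rewrite mulrC Re_pmull // mulr_ge0 // ltW.
  have -> : w * z = `|z| * (z + `|z|).
    by rewrite mulrDl mulrDr [z^* * _]mulrC -normCK expr2.
  rewrite Re_pmull ?normr_gt0 //.
  rewrite mulr_ge0 // raddfD /= (Creal_ReP `|z| _) ?normr_real //.
  by move: Rw; rewrite /w raddfD /= real_conj (Creal_ReP `|z| _) ?normr_real // addrC => /ltW.
exists 0%N => //; rewrite /update ltn_eqF // mulrC Re_pmull // mulr_gt0 //.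
Qed.

(** The hypothesis, that the product of the linear forms has capacity at least 1, is the case m = n.
    Each step sets the last variable to the value that is best for the AM-GM bound and passes to the
    coefficient of X. The constants telescope to m^m, and m = 0 leaves the bound n!/n^n for the
    permanent. *)
Lemma gurvits_capacity m (x : nat -> C) :
  (forall y : nat -> C, (forall l, 0 < y l) ->
     \prod_(l < n) y l <= \prod_(i < n) \sum_(l < n) a i l * y l) ->
  (m <= n)%N -> (forall l, 0 < x l) ->
  n`!%:R * m%:R ^+ m * \prod_(l < m) x l <= n%:R ^+ n * mixed_per a m x.
Proof.
move=> cap mn; rewrite -(subKn mn); move: (leq_subr m n).
elim: (n - m)%N x => [x _ x0|d IH x dn x0].
  rewrite subn0 mixed_per_full mulrA [n%:R ^+ n * _]mulrC ler_wpM2l ?cap //.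
set k := (n - d.+1)%N in x0 *.
have kn : (k < n)%N by rewrite ltn_subrL (leq_trans _ dn).
have kE : (n - d)%N = k.+1 by rewrite subnSK.
(* For k = 0 the constant term of the slice is 0 and the optimisation below breaks down. But
   [mixed_per a 1] at the constant 1 already is [mixed_per a 0], and 1^1 = 0^0 = 1. *)
have [k0|k0] := posnP k.
  have := IH (fun=> 1) (ltnW dn) (fun=> ltr01); rewrite kE k0 big_ord1 big_ord0 expr1 expr0.
  congr (_ <= _ * _); apply: eq_bigr => s _; apply: eq_bigr => j _.
  by rewrite ltnS leqn0 big_ord1 mulr1; case: eqP => [->|].
pose f := slice a k x.
have qk : 0 < mixed_per a k x.
  by apply: mixed_per_gt0 => [l _|]; [apply: ltW|exists 0%N].
have f0 : 0 < f`_0.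
  rewrite -horner_coef0 horner_slice mixed_per_gt0 // => [l _|].
    by rewrite /update; case: eqP => // _; apply: ltW.
  by exists 0%N => //; rewrite /update ltn_eqF.
have f1 : f`_1 = k.+1%:R * mixed_per a k x by apply: coef1_slice.
(* The minimiser over t of (1 + t f_1/(f_0 (k+1)))^(k+1) / t, where f_1 = (k+1)
   [mixed_per a k x]. *)
pose t := f`_0 / (k%:R * mixed_per a k x).
have kR : 0 < k%:R :> C by rewrite ltr0n.
have t0 : 0 < t by rewrite divr_gt0 // mulr_gt0.
have [|_] := @horner_le_AGM _ f k.+1 t (size_slice a_gt0 _ kn) f0 (ltW t0).
  by move=> z; apply: root_slice_lt0; rewrite ?k0.
have upos l : 0 < update x k t l by rewrite /update; case: eqP.
have := IH (update x k t) (ltnW dn) upos; rewrite kE -horner_slice -/f.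
rewrite big_ord_recr /=; have -> : update x k t k = t by rewrite /update eqxx.
rewrite (eq_bigr (fun l : 'I_k => x l)) => [IHt ft|l _]; last by rewrite /update ltn_eqF.
have tE : 1 + t * (f`_1 / f`_0) / k.+1%:R = k.+1%:R / k%:R.
  by rewrite f1 /t -natr1; field; rewrite !gt_eqF // addr_gt0.
rewrite tE in ft.
have := le_trans IHt (ler_wpM2l (exprn_ge0 n (ler0n _ n)) ft).
set X := \prod_(l < k) x l; set q := mixed_per a k x.
have c0 : 0 < f`_0 * (k.+1%:R / k%:R) ^+ k.+1 / q by rewrite divr_gt0 ?mulr_gt0 ?exprn_gt0 ?divr_gt0 ?ltr0n.
move=> H; rewrite -(ler_pM2r c0) -/q; move: H.
have kk : k%:R ^+ k != 0 :> C by rewrite gt_eqF // exprn_gt0.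
have [k_neq q_neq] : k%:R != 0 :> C /\ q != 0 by rewrite !gt_eqF.
congr (_ <= _); rewrite /t -/q expr_div_n ![_ ^+ k.+1]exprS.
  have alg (K1 K F Q P1 P N Z : C) : K != 0 -> Q != 0 -> P != 0 ->
    N * (K1 * P1) * (Z * (F / (K * Q))) = N * P * Z * (F * (K1 * P1 / (K * P)) / Q).
    by move=> *; field; apply/and3P.
  exact: alg.
by rewrite -[RHS]mulrA [q * _]mulrC divfK.
Qed.
End MixedPermanent.

(** AM-GM for the multiset in which [y l] occurs [b l] times. *)
Lemma weighted_AGM (C : numFieldType) (n K : nat) (b : 'I_n -> nat) (y : 'I_n -> C) :
  (\sum_l b l)%N = K -> (forall l, 0 < y l) ->
  \prod_l y l ^+ b l <= (\sum_l (b l)%:R / K%:R * y l) ^+ K.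
Proof.
move=> bK y0; pose I := {l : 'I_n & 'I_(b l)}.
have cI : #|{: I}| = K.
  by rewrite card_tagged sumnE big_map big_enum -bK; apply: eq_bigr => l _; rewrite card_ord.
have := @leif_AGM _ _ {: I} (fun p => y (tag p)).
rewrite cI => /(_ (fun p _ => ltW (y0 _))) H; apply: le_trans (le_trans _ H) _.
  rewrite -(@sig_big_dep _ _ _ _ _ xpredT (fun l => xpredT) (fun l (j : 'I_(b l)) => y l)) /=.
  by rewrite le_eqVlt; apply/orP; left; apply/eqP; apply: eq_bigr => l _; rewrite prodr_const card_ord.
rewrite -(@sig_big_dep _ _ _ _ _ xpredT (fun l => xpredT) (fun l (j : 'I_(b l)) => y l)) /=.
rewrite mulr_suml le_eqVlt; apply/orP; left; apply/eqP; congr (_ ^+ _).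
by apply: eq_bigr => l _; rewrite sumr_const card_ord -[y l *+ _]mulr_natl mulrAC.
Qed.

(** The van der Waerden bound n!/n^n for the doubly stochastic matrix b/K, cleared of denominators.
    The capacity is at least 1 by weighted AM-GM in every row: in the product over the rows, [y l]
    gets the column sum K as exponent. *)
Lemma permanent_ge_pos (n K : nat) (b : 'I_n -> 'I_n -> nat) :
  (forall i l, 0 < b i l)%N -> (forall i, \sum_l b i l = K)%N ->
  (forall l, \sum_i b i l = K)%N ->
  (n`! * K ^ n <= n ^ n * \sum_(s : 'S_n) \prod_j b (s j) j)%N.
Proof.
move=> b0 bR bC; case: n b b0 bR bC => [|n] b b0 bR bC.
  by rewrite !expn0 fact0 !mul1n (bigD1 1%g) //= big_ord0.
have K0 : (0 < K)%N by rewrite -(bR ord0) (bigD1 ord0) //= ltn_addr.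
(* Columns beyond the matrix get the entry 1/K, because positivity is asked for every natural number
   l. *)
pose a (i : 'I_n.+1) (l : nat) : algC := (oapp (b i) 1%N (insub l))%:R / K%:R.
have aE i (l : 'I_n.+1) : a i l = (b i l)%:R / K%:R by rewrite /a valK.
have KR : 0 < K%:R :> algC by rewrite ltr0n.
have a0 i l : 0 < a i l.
  by rewrite divr_gt0 // ltr0n; case: (insub l) => [u|] /=; rewrite ?b0.
have := @gurvits_capacity algC n.+1 a a0 0 (fun=> 1) _ (leq0n _) (fun=> ltr01).
rewrite big_ord0 expr0 !mulr1 => /(_ _) H.
have {H} H : (n.+1)`!%:R <= n.+1%:R ^+ n.+1 * mixed_per a 0 (fun=> 1).
  apply: H => y y0.
  have S0 i : 0 < \sum_(l < n.+1) a i l * y l.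
    rewrite big_ord_recl; apply: ltr_pwDl; first exact: mulr_gt0.
    by apply: sumr_ge0 => l _; apply: ltW (mulr_gt0 (a0 _ _) (y0 _)).
  have yP : 0 <= \prod_(l < n.+1) y l by apply: prodr_ge0 => l _; apply: ltW.
  have SP : 0 <= \prod_(i < n.+1) \sum_(l < n.+1) a i l * y l.
    by apply: prodr_ge0 => i _; apply: ltW.
  rewrite -(ler_pXn2r K0) ?nnegrE // -!prodrXl.
  apply: (@le_trans _ _ (\prod_(i < n.+1) \prod_(l < n.+1) y l ^+ b i l)).
    rewrite exchange_big /= le_eqVlt; apply/orP; left; apply/eqP.
    by apply: eq_bigr => l _; rewrite prodrXr bC.
  apply: ler_prod => i _; rewrite prodr_ge0 => [|l _]; last by rewrite exprn_ge0 // ltW.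
  under [X in _ <= X ^+ _]eq_bigr do rewrite aE.
  by apply: weighted_AGM.
have mE : mixed_per a 0 (fun=> 1) = (\sum_(s : 'S_n.+1) \prod_j b (s j) j)%:R / K%:R ^+ n.+1.
  rewrite natr_sum mulr_suml; apply: eq_bigr => s _.
  rewrite natr_prod; have -> : K%:R ^+ n.+1 = \prod_(j < n.+1) K%:R :> algC by rewrite prodr_const card_ord.
  rewrite -prodf_div.
  by apply: eq_bigr => j _; rewrite /= aE.
rewrite -(ler_nat algC) (natrM _ (n.+1)`!) (natrM _ (n.+1 ^ n.+1)%N) !natrX -ler_pdivlMr ?exprn_gt0 //.
by rewrite -mulrA -mE.
Qed.

Theorem permanent_ge_regular (n k : nat) (A : 'I_n -> 'I_n -> bool) :
  (forall i, \sum_l A i l = k)%N -> (forall l, \sum_i A i l = k)%N ->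
  (n`! * k ^ n <= n ^ n * #|[set s : 'S_n | [forall j, A (s j) j]]|)%N.
Proof.
case: n A => [|n] A AR AC.
  rewrite !expn0 fact0 !mul1n card_gt0; apply/set0Pn; exists 1%g.
  by rewrite inE; apply/forallP => -[].
set P := [set s | _]; rewrite leqNgt; apply/negP => lt.
have kn : (k <= n.+1)%N.
  rewrite -(AR ord0); apply: (@leq_trans (\sum_(l < n.+1) 1)%N).
    by apply: leq_sum => l _; case: (A _ _).
  by rewrite sum1_card card_ord.
(* The bound for positive matrices applies to [M * A + 1]; for this [M] the
   error terms are too small to bridge the gap between integers. *)
pose M := (n.+1 ^ n.+1 * n.+1`!)%N; pose K := (M * k + n.+1)%N.
pose b i l := (M * A i l + 1)%N.
have bR i : (\sum_l b i l = K)%N.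
  by rewrite big_split /= -big_distrr /= AR sum1_card card_ord.
have bC l : (\sum_i b i l = K)%N.
  by rewrite big_split /= -big_distrr /= AC sum1_card card_ord.
have b0 i l : (0 < b i l)%N by rewrite /b addn1.
have bM i l : (b i l <= M.+1)%N by rewrite /b; case: (A i l); rewrite ?muln1 ?muln0 ?addn1.
(* A permutation outside P meets a zero of A, where b is 1 instead of up to M + 1; this saves one
   factor M + 1. *)
have perb : (\sum_(s : 'S_n.+1) \prod_j b (s j) j <=
             #|P| * M.+1 ^ n.+1 + n.+1`! * M.+1 ^ n)%N.
  rewrite (bigID (mem P)) /=; apply: leq_add.
    rewrite -sum_nat_const; apply: leq_sum => s _.
    rewrite -[X in (_ <= _ ^ X)%N]card_ord -prod_nat_const; exact: leq_prod.
  rewrite -card_Sn -[X in (_ <= X * _)%N]cardsT -sum_nat_const.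
  rewrite [leqRHS](bigID (mem P)) /=.
  apply: leq_trans (leq_addl _ _).
  rewrite [leqRHS](eq_bigl (fun s => s \notin P)) => [|s]; last by rewrite inE.
  apply: leq_sum => s; rewrite inE negb_forall => /existsP[j0 /negbTE Aj0].
  rewrite (bigD1 j0) //= /b Aj0 muln0 mul1n.
  apply: (@leq_trans (\prod_(i < n.+1 | i != j0) M.+1)%N); first by apply: leq_prod => i _; apply: bM.
  by rewrite prod_nat_const cardC1 card_ord.
have := permanent_ge_pos b0 bR bC.
have kK : (M.+1 * k <= K)%N by rewrite mulSn addnC leq_add2l.
have kK' : ((M.+1 * k) ^ n.+1 <= K ^ n.+1)%N by rewrite leq_exp2r.
move/(leq_trans (leq_mul (leqnn (n.+1)`!) kK')).
move/leq_trans => /(_ _ (leq_mul (leqnn _) perb)).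
rewrite expnMn expnS; set Q := (M.+1 ^ n)%N.
have Q0 : (0 < Q)%N by rewrite expn_gt0.
have -> : ((n.+1)`! * (M.+1 * Q * k ^ n.+1) = (n.+1)`! * k ^ n.+1 * M.+1 * Q)%N by lia.
have -> : (n.+1 ^ n.+1 * (#|P| * (M.+1 * Q) + (n.+1)`! * Q) =
  (n.+1 ^ n.+1 * #|P| * M.+1 + M) * Q)%N by rewrite /M; lia.
rewrite leq_pmul2r //; apply/negP; rewrite -ltnNge.
apply: leq_trans (leq_mul lt (leqnn M.+1)); rewrite mulSn addnC; lia.
Qed.

(** * Lower bound on the number of Latin squares *)

Section LatinRectangles.
Variable n : nat.

Definition disjoint_perms (p q : 'S_n) : bool := [forall x, p x != q x].

Definition latin_rectangles (m : nat) : {set m.-tuple 'S_n} :=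
  [set t : m.-tuple 'S_n | pairwise disjoint_perms t].

Lemma card_missing (t : seq 'S_n) (f : 'S_n -> 'I_n) :
  pairwise (fun p q => f p != f q) t ->
  (\sum_(i < n) all (fun p => f p != i) t = n - size t)%N.
Proof.
move=> ft; have ut : uniq (map f t) by rewrite uniq_pairwise pairwise_map.
rewrite -(size_map f) -(card_uniqP ut) -[X in (X - _)%N]card_ord -(cardC (mem (map f t))) addKn -sum1_card.
rewrite [RHS]big_mkcond /=; apply: eq_bigr => i _; rewrite inE.
case: (boolP (i \in map f t)) => [/mapP[p pt ->]|H] /=.
  by case: allP => // /(_ _ pt); rewrite eqxx.
by case: allP => // -[] p pt; apply: contraNneq H => <-; apply: map_f.
Qed.

(** The symbols still free in each column form an (n-m)-regular bipartite graph between symbols and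
    columns: a rectangle has m distinct symbols in every column and every symbol in m distinct
    columns. Perfect matchings of this graph are the possible next rows. *)
Lemma card_latin_rectangles_ge m : (m <= n)%N ->
  (#|latin_rectangles m| * (n`! * (n - m) ^ n) <= n ^ n * #|latin_rectangles m.+1|)%N.
Proof.
move=> mn; pose D := [set tp : m.-tuple 'S_n * 'S_n |
  (tp.1 \in latin_rectangles m) && (all (disjoint_perms tp.2) tp.1)].
have DR : (#|D| <= #|latin_rectangles m.+1|)%N.
  have inj : injective (fun tp : m.-tuple 'S_n * 'S_n => [tuple of tp.2 :: tp.1]).
    by move=> [t p] [u q] /(congr1 val) [-> tu]; congr (_, _); apply: val_inj.
  rewrite -(card_imset _ inj); apply/subset_leq_card/subsetP => _ /imsetP[[p t] + ->].
  by rewrite !inE /= andbC.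
apply: leq_trans (leq_mul (leqnn _) DR).
have -> : #|D| = (\sum_(t in latin_rectangles m) #|[set p | all (disjoint_perms p) t]|)%N.
  rewrite -sum1_card (eq_bigl (fun tp => (tp.1 \in latin_rectangles m) &&
     (tp.2 \in [set p | all (disjoint_perms p) tp.1]))); last by move=> pt; rewrite !inE.
  rewrite -(pair_big_dep (fun t => t \in latin_rectangles m)
     (fun t p => p \in [set p | all (disjoint_perms p) t]) (fun _ _ => 1%N)) /=.
  by apply: eq_bigr => t _; rewrite sum1_card.
rewrite -sum_nat_const big_distrr /=; apply: leq_sum => t; rewrite inE => tR.
pose A (i j : 'I_n) := all (fun q : 'S_n => q j != i) t.
have AR i : (\sum_l A i l = n - m)%N.
  rewrite -[in RHS](size_tuple t) -(card_missing (f := fun q : 'S_n => (q^-1)%g i)).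
    apply: eq_bigr => l _; congr (nat_of_bool _); apply: eq_all => q.
    by rewrite -[in RHS](inj_eq (@perm_inj _ q)) permKV eq_sym.
  apply: sub_pairwise tR => p q /forallP /(_ ((p^-1)%g i)); rewrite permKV.
  by apply: contraNneq => ->; rewrite permKV.
have AC l : (\sum_i A i l = n - m)%N.
  rewrite -[in RHS](size_tuple t) -(card_missing (f := fun q : 'S_n => q l)) //.
  by apply: sub_pairwise tR => p q /forallP /(_ l).
apply: leq_trans (permanent_ge_regular AR AC) _; rewrite leq_mul2l.
apply/orP; right; apply/subset_leq_card/subsetP => p; rewrite !inE => /forallP pA.
apply/allP => q qt; apply/forallP => j.
by have /allP/(_ _ qt) := pA j; rewrite eq_sym.
Qed.

Lemma card_latin_rectangles_prod m : (m <= n)%N ->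
  (n`! ^ m * (\prod_(i < m) (n - i)) ^ n <= n ^ (n * m) * #|latin_rectangles m|)%N.
Proof.
elim: m => [_|m IH mn].
  rewrite expn0 big_ord0 exp1n muln0 expn0 !mul1n card_gt0.
  by apply/set0Pn; exists [tuple]; rewrite inE.
have := leq_mul (IH (ltnW mn)) (leqnn (n`! * (n - m) ^ n)%N).
have := leq_mul (leqnn (n ^ (n * m))%N) (card_latin_rectangles_ge (ltnW mn)).
rewrite big_ord_recr expnMn expnS mulnS expnD /=.
set a := (n ^ (n * m))%N; set b := #|_|; set c := (n`! * _)%N; set d := #|_|.
by rewrite /c; nia.
Qed.

(** For m = n the product of the n - i is n! as well. With n! >= (n/e)^n the bound becomes
    (n/e^2)^(n^2). *)
Lemma card_latin_ge : (n`! ^ (2 * n) <= n ^ (n * n) * #|latin n|)%N.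
Proof.
have prodE : (\prod_(i < n) (n - i) = n`!)%N.
  by rewrite -ffactnn ffact_prod.
have := card_latin_rectangles_prod (leqnn n); rewrite prodE -expnD addnn -mul2n.
move=> /leq_trans; apply; rewrite leq_mul2l; apply/orP; right.
have ltP (t : n.-tuple 'S_n) : t \in latin_rectangles n ->
    is_latin [ffun i => tnth t i].
  rewrite inE => tR; apply/forallP => i; apply/forallP => j; apply/implyP => ij.
  apply/forallP => x; rewrite !ffunE.
  move/(pairwiseP 1%g): tR => /(_ i j); rewrite !inE size_tuple !ltn_ord => /(_ isT isT ij).
  by move/forallP => /(_ ((tnth t j)^-1 x)%g); rewrite !(tnth_nth 1%g) permKV.
have inj : injective (fun t : n.-tuple 'S_n => [ffun i => tnth t i]).
  move=> t u /ffunP tu; apply: eq_from_tnth => i; have := tu i; by rewrite !ffunE.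
rewrite -(card_imset _ inj) card_sig; apply/subset_leq_card/subsetP => _ /imsetP[t tR ->].
by rewrite inE ltP.
Qed.
End LatinRectangles.

(** * Squares that miss a dense set of triples *)

Section SequentialWeight.
Variables (R : realFieldType) (cell V T : finType) (ev : T -> cell -> V).
Variable w : seq (cell * V) -> cell -> V -> R.
Hypothesis w_ge0 : forall h c v, 0 <= w h c v.
Hypothesis w_le1 : forall h c, \sum_v w h c v <= 1.

Fixpoint seq_weight (h : seq (cell * V)) (cs : seq cell) (x : T) : R :=
  if cs is c :: cs' then w h c (ev x c) * seq_weight (rcons h (c, ev x c)) cs' x
  else 1.

(** [w h c v] is the chance of the value v at c after the history h, so [seq_weight] is the
    probability that a random process reveals x. Elements that differ on [cs] are disjoint outcomes
    of this process. *)
Lemma sum_seq_weight_le1 (cs : seq cell) (h : seq (cell * V)) (S : {set T}) :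
  {in S &, forall x y, {in cs, ev x =1 ev y} -> x = y} ->
  \sum_(x in S) seq_weight h cs x <= 1.
Proof.
elim: cs h S => [|c cs IH] h S inj /=.
  rewrite sumr_const lern1.
  by apply/card_le1_eqP => x y xS yS; apply: inj.
rewrite (partition_big (fun x => ev x c) xpredT) //=.
apply: le_trans (w_le1 h c); apply: ler_sum => v _.
rewrite (eq_bigr (fun x => w h c v * seq_weight (rcons h (c, v)) cs x)); last first.
  by move=> x /andP[_ /eqP ->].
rewrite -mulr_sumr ler_piMr //.
rewrite (eq_bigl (fun x => x \in [set x in S | ev x c == v])) => [|x]; last by rewrite inE.
apply: IH => x y; rewrite !inE => /andP[xS /eqP xv] /andP[yS /eqP yv] xy.
by apply: inj => // d; rewrite inE => /orP[/eqP ->|/xy //]; rewrite xv yv.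
Qed.
End SequentialWeight.

Section LatinWeight.
Variables (R : realFieldType) (n : nat) (rho : 'I_n * 'I_n -> 'I_n -> R).
Hypothesis rho_gt0 : forall c v, 0 < rho c v.
Local Notation cell := ('I_n * 'I_n)%type.

Definition entry (L : latin n) (c : cell) : 'I_n := val L c.1 c.2.

Lemma latin_row_inj (L : latin n) i i' j :
  entry L (i, j) = entry L (i', j) -> i = i'.
Proof.
wlog ii : i i' / (i <= i')%N => [H|] e.
  by case/orP: (leq_total i i') => ii; [|apply/esym]; apply: H.
case: (ltngtP i i') ii e => [ii _|//|/val_inj //]; rewrite /entry /= => e.
have /forallP/(_ i)/forallP/(_ i')/implyP/(_ ii)/forallP/(_ (val L i' j)) := valP L.
by rewrite permK e eqxx.
Qed.

Definition available (h : seq (cell * 'I_n)) (c : cell) (v : 'I_n) : bool :=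
  all (fun p => ((p.1.1 == c.1) || (p.1.2 == c.2)) ==> (p.2 != v)) h.

Definition greedy_weight (h : seq (cell * 'I_n)) (c : cell) (v : 'I_n) : R :=
  if available h c v then rho c v / \sum_(u | available h c u) rho c u else 0.

Variable M : nat.

Definition row_cell (L : latin n) (c : cell) (v : 'I_n) : cell :=
  (c.1, ((val L c.1)^-1)%g v).

Lemma col_perm_proof (L : latin n) (j : 'I_n) : injective (fun i => val L i j).
Proof. by move=> i i'; apply: latin_row_inj. Qed.

Definition col_perm (L : latin n) (j : 'I_n) : 'S_n := perm (@col_perm_proof L j).

Definition col_cell (L : latin n) (c : cell) (v : 'I_n) : cell :=
  (((col_perm L c.2)^-1)%g v, c.2).

Lemma entry_row_cell L c v : entry L (row_cell L c v) = v.
Proof. by rewrite /entry /= permKV. Qed.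

Lemma entry_col_cell L c v : entry L (col_cell L c v) = v.
Proof.
by rewrite /entry /=; have := permKV (col_perm L c.2) v; rewrite {1}permE.
Qed.

(* If the cells are revealed by increasing [tau], the symbols available at [c]
   are among those that [L] has neither in the row nor in the column of [c] at a
   cell revealed strictly earlier; this bounds the sum of their weights. *)
Definition late_sum (L : latin n) (tau : {ffun cell -> 'I_M}) (c : cell) : R :=
  \sum_(v | (tau c <= tau (row_cell L c v))%N && (tau c <= tau (col_cell L c v))%N)
    rho c v.

Lemma row_cell_entry L c : row_cell L c (entry L c) = c.
Proof. by case: c => i j; rewrite /row_cell /entry /= permK. Qed.

Lemma col_cell_entry L c : col_cell L c (entry L c) = c.
Proof.
case: c => i j; rewrite /col_cell /entry /=; congr (_, _).
by rewrite -[val L i j](permE (@col_perm_proof L j)) permK.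
Qed.

Lemma late_sum_gt0 L tau c : 0 < late_sum L tau c.
Proof.
rewrite /late_sum (bigD1 (entry L c)) /=; last by rewrite row_cell_entry col_cell_entry !leqnn.
by rewrite ltr_wpDr // sumr_ge0 // => v _; apply: ltW.
Qed.

(** The greedy process visits the cells in the order of [tau] and picks an available symbol with
    probability proportional to [rho c]; it produces L with at least the stated probability. Ties of
    [tau] are broken by [sort], and since [late_sum] counts tied cells as late, it still dominates
    the weight of the available symbols. *)
Lemma sum_latin_weight_le1 (tau : {ffun cell -> 'I_M}) :
  \sum_(L : latin n) \prod_c (rho c (entry L c) / late_sum L tau c) <= 1.
Proof.
pose le (c d : cell) := (tau c <= tau d)%N.
have leT : total le by move=> c d; apply: leq_total.
have le_tr : transitive le by move=> c d e; apply: leq_trans.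
pose cs := sort le (enum {: cell}).
have ucs : uniq cs by rewrite sort_uniq enum_uniq.
have mem_cs c : c \in cs by rewrite mem_sort mem_enum.
have scs : pairwise le cs by rewrite -sorted_pairwise // sort_sorted.
have w0 h c v : 0 <= greedy_weight h c v.
  rewrite /greedy_weight; case: ifP => // _.
  by rewrite divr_ge0 ?sumr_ge0 // => *; apply: ltW.
have w1 h c : \sum_v greedy_weight h c v <= 1.
  rewrite /greedy_weight -big_mkcond /= -mulr_suml.
  have [->|N0] := eqVneq (\sum_(v | available h c v) rho c v) 0; last by rewrite mulfV.
  by rewrite mul0r.
apply: le_trans (sum_seq_weight_le1 (ev := entry) (cs := cs) w0 w1 [::] (S := [set: latin n]) _); last first.
  move=> L L' _ _ LL'; apply/val_inj/ffunP => i; apply/permP => j.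
  exact: (LL' (i, j) (mem_cs _)).
rewrite [leRHS](eq_bigl xpredT) => [|L]; last by rewrite inE.
apply: ler_sum => L _.
have : forall post pre, pre ++ post = cs ->
   \prod_(c <- post) (rho c (entry L c) / late_sum L tau c) <=
   seq_weight entry greedy_weight [seq (c, entry L c) | c <- pre] post L.
  elim=> [|c post IH] pre ecs; first by rewrite big_nil.
  rewrite big_cons /= ler_pM //.
  - by rewrite divr_ge0 ?ltW // late_sum_gt0.
  - by apply: prodr_ge0 => d _; rewrite divr_ge0 ?ltW // late_sum_gt0.
  - have cpre : c \notin pre.
      by move: ucs; rewrite -ecs cat_uniq /= negb_or => /and3P[_ /andP[]].
    have av : available [seq (d, entry L d) | d <- pre] c (entry L c).
      apply/allP => _ /mapP[d dpre ->] /=; apply/implyP => same.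
      apply: contraNneq cpre => e; suff <- : d = c by [].
      case/orP: same => /eqP; case: d c e {dpre ecs} => i j [i' j'] /= e ii.
        by rewrite ii in e *; congr (_, _); apply: (@perm_inj _ (val L i')).
      by rewrite ii in e *; congr (_, _); apply: (latin_row_inj e).
    rewrite /greedy_weight av ler_pM2l // lef_pV2 ?posrE ?late_sum_gt0 //; last first.
      rewrite (bigD1 (entry L c)) //= ltr_wpDr // sumr_ge0 // => v _; exact: ltW.
    have late d v : entry L d = v -> (d.1 == c.1) || (d.2 == c.2) ->
        available [seq (d, entry L d) | d <- pre] c v -> (tau c <= tau d)%N.
      move=> <- same avd; rewrite leqNgt; apply/negP => dc.
      have dpre : d \in pre.
        have := mem_cs d; rewrite -ecs mem_cat => /orP[//|].
        move: scs; rewrite -ecs pairwise_cat /= => /and3P[_ _ /andP[/allP cpost _]].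
        rewrite inE => /orP[/eqP dE|/cpost]; first by rewrite dE ltnn in dc.
        by rewrite /le leqNgt dc.
      by have /allP/(_ _ (map_f _ dpre)) := avd; rewrite /= same eqxx.
    rewrite /late_sum [leRHS]big_mkcond [leLHS]big_mkcond; apply: ler_sum => v _.
    case: ifP => [avv|_]; last by case: ifP => // _; apply: ltW.
    rewrite (late (row_cell L c v) v) ?entry_row_cell ?eqxx //.
    by rewrite (late (col_cell L c v) v) ?entry_col_cell ?eqxx ?orbT.
  - by have := IH (rcons pre c); rewrite cat_rcons map_rcons; apply.
move=> /(_ cs [::] erefl); apply: le_trans; rewrite le_eqVlt; apply/orP; left; apply/eqP.
by rewrite [RHS](perm_big (enum {: cell})) ?perm_sort //= big_enum.
Qed.
End LatinWeight.

(** * Averages over independent random times of the cells *)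

Section Average.
Variables (R : realType) (I : finType) (M : nat).
Hypothesis M_gt0 : (0 < M)%N.

Definition average (F : {ffun I -> 'I_M} -> R) : R :=
  (\sum_tau F tau) / M%:R ^+ #|I|.

Lemma average_sum (J : finType) (P : pred J) (F : J -> {ffun I -> 'I_M} -> R) :
  average (fun tau => \sum_(j | P j) F j tau) = \sum_(j | P j) average (F j).
Proof. by rewrite /average exchange_big mulr_suml. Qed.

Lemma averageZ c F : average (fun tau => c * F tau) = c * average F.
Proof. by rewrite /average -mulr_sumr mulrA. Qed.

Lemma averageD F G : average (fun tau => F tau + G tau) = average F + average G.
Proof. by rewrite /average big_split mulrDl. Qed.

Lemma ler_average F G : (forall tau, F tau <= G tau) -> average F <= average G.
Proof.
move=> FG; rewrite ler_wpM2r ?invr_ge0 ?exprn_ge0 ?ler0n //.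
by apply: ler_sum => tau _.
Qed.

Lemma eq_average F G : (forall tau, F tau = G tau) -> average F = average G.
Proof. by move=> FG; congr (_ / _); apply: eq_bigr => tau _. Qed.

Lemma average_const c : average (fun=> c) = c.
Proof.
rewrite /average sumr_const card_ffun card_ord -[c *+ _]mulr_natr natrX mulfK //.
by rewrite expf_neq0 // pnatr_eq0 -lt0n.
Qed.

Lemma average_prod (g : I -> 'I_M -> R) :
  average (fun tau => \prod_i g i (tau i)) = \prod_i ((\sum_t g i t) / M%:R).
Proof. by rewrite /average -bigA_distr_bigA big_split /= prodr_const exprVn. Qed.

Lemma expR_average F : expR (average F) <= average (fun tau => expR (F tau)).
Proof.
rewrite -(ler_pM2l (expR_gt0 (- average F))) [leLHS]mulrC expRxMexpNx_1 -averageZ.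
have -> : 1 = average (fun tau => 1 + (F tau - average F)).
  by rewrite !averageD !average_const subrr addr0.
apply: ler_average => tau; rewrite -expRD [- _ + _]addrC.
exact: expR_ge1Dx.
Qed.

(** The probability that a uniform time is at least t. *)
Definition remaining (t : 'I_M) : R := (M - t)%:R / M%:R.

Lemma remaining_gt0 t : 0 < remaining t.
Proof. by rewrite divr_gt0 ?ltr0n ?subn_gt0. Qed.

Lemma average_late (h : 'I_M -> R) (c : I) (D : {set I}) : c \notin D ->
  average (fun tau => h (tau c) * [forall d in D, (tau c <= tau d)%N]%:R) =
  (\sum_t h t * remaining t ^+ #|D|) / M%:R.
Proof.
move=> cD; have M0 : M%:R != 0 :> R by rewrite pnatr_eq0 -lt0n.
pose g t d (u : 'I_M) : R := if d == c then (u == t)%:R * h t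
  else if d \in D then (t <= u)%N%:R else 1.
rewrite (@eq_average _ (fun tau => \sum_t \prod_d g t d (tau d))) => [|tau].
  rewrite average_sum mulr_suml; apply: eq_bigr => t _; rewrite average_prod.
  rewrite (bigD1 c) //= mulrAC; congr (_ * _ / _).
    rewrite (bigD1 t) //= /g !eqxx mul1r big1 ?addr0 // => u /negbTE ->.
    by rewrite mul0r.
  rewrite -prodr_const [RHS]big_mkcond [RHS](bigD1 c) //= (negbTE cD) mul1r.
  apply: eq_bigr => d dc; rewrite /g (negbTE dc); case: ifP => _.
    rewrite -natr_sum; congr (_%:R / _).
    rewrite -(big_mkord xpredT (fun u => nat_of_bool (t <= u)%N)).
    rewrite (big_cat_nat (n := t)) ?(ltnW (ltn_ord t)) //= big_nat_cond big1 ?add0n => [|u].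
      rewrite big_nat_cond (eq_bigr (fun=> 1%N)) => [|u /andP[/andP[-> _] _] //].
      by rewrite -big_nat_cond sum_nat_const_nat muln1.
    by rewrite andbT => /andP[_ ut]; rewrite leqNgt ut.
  by rewrite sumr_const card_ord divff.
rewrite (bigD1 (tau c)) //= [X in _ + X]big1 ?addr0 => [|t tc].
  rewrite (bigD1 c) //= {1}/g !eqxx mul1r; congr (_ * _).
  case: (boolP [forall _ in _, _]) => [/forall_inP H|].
    rewrite big1 // => d dc; rewrite /g (negbTE dc); case: ifP => // /H ->.
    by [].
  rewrite negb_forall_in => /exists_inP[d dD /negbTE td].
  have dc : d != c by apply: contraNneq cD => <-.
  by rewrite (bigD1 d) //= /g (negbTE dc) dD td mul0r.
by rewrite (bigD1 c) //= /g eqxx eq_sym (negbTE tc) !mul0r.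
Qed.
End Average.

Lemma ln_le_tangent (R : realType) (x l : R) : 0 < x -> 0 < l ->
  ln x <= ln l + x / l - 1.
Proof.
move=> x0 l0; have xl : 0 < x / l by rewrite divr_gt0.
have := @le_ln1Dx _ (x / l - 1); rewrite [1 + _]addrC subrK ln_div ?posrE // => H.
have /H : -1 < x / l - 1 by lra.
by lra.
Qed.

Lemma average_at (R : realType) (I : finType) (M : nat) (h : 'I_M -> R) (c : I) :
  (0 < M)%N -> average (fun tau => h (tau c)) = (\sum_t h t) / M%:R.
Proof.
move=> M0; have cD : c \notin (set0 : {set I}) by rewrite inE.
have := average_late M0 h cD.
rewrite cards0 (eq_bigr h) => [<-|t _]; last by rewrite expr0 mulr1.
apply: eq_average => tau.
suff -> : [forall d in set0, (tau c <= tau d)%N] by rewrite mulr1.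
by apply/forall_inP => d; rewrite inE.
Qed.

Section LatinCount.
Variables (R : realType) (n M : nat) (rho : 'I_n * 'I_n -> 'I_n -> R).
Hypothesis rho_gt0 : forall c v, 0 < rho c v.
Hypothesis rho_le1 : forall c v, rho c v <= 1.
Hypothesis n_gt0 : (0 < n)%N.
Hypothesis M_gt0 : (0 < M)%N.

Definition log_scale : R := (\sum_(t < M) ln (n%:R * remaining R t ^+ 2)) / M%:R.

(* The logarithm is replaced by its tangent at [n * remaining t ^+ 2], the mean
   number of available symbols at time [t]: a symbol is available when its cells
   in the row and in the column of [c] are both late. *)
Lemma average_ln_late_sum (L : latin n) c :
  average (fun tau : {ffun 'I_n * 'I_n -> 'I_M} => ln (late_sum rho L tau c)) <=
  log_scale + M%:R ^+ 2 / n%:R + (\sum_v rho c v) / n%:R - 1.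
Proof.
have nR : 0 < n%:R :> R by rewrite ltr0n.
have MR : 0 < M%:R :> R by rewrite ltr0n.
pose l (t : 'I_M) : R := n%:R * remaining R t ^+ 2.
have r0 t : 0 < remaining R t := remaining_gt0 R M_gt0 t.
have l0 t : 0 < l t by rewrite /l mulr_gt0 // exprn_gt0.
pose D v := [set row_cell L c v; col_cell L c v].
pose late v (tau : {ffun 'I_n * 'I_n -> 'I_M}) := [forall d in D v, (tau c <= tau d)%N].
have lateE v tau : late v tau = (tau c <= tau (row_cell L c v))%N && (tau c <= tau (col_cell L c v))%N.
  apply/forall_inP/andP => [H|[H1 H2] d]; first by rewrite !H ?inE ?eqxx ?orbT.
  by rewrite !inE => /orP[] /eqP ->.
apply: (@le_trans _ _ (average (fun tau : {ffun 'I_n * 'I_n -> 'I_M} => (ln (l (tau c)) - 1) +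
   \sum_v rho c v * ((l (tau c))^-1 * (late v tau)%:R)))).
  apply: ler_average => tau; apply: le_trans (ln_le_tangent (late_sum_gt0 rho_gt0 L tau c) (l0 (tau c))) _.
  rewrite addrAC lerD2l /late_sum mulr_suml big_mkcond le_eqVlt; apply/orP; left; apply/eqP.
  apply: eq_bigr => v _; rewrite -lateE; case: (late v tau); rewrite ?mulr1 ?mulr0 //.
rewrite averageD (average_at (fun t => ln (l t) - 1)) // average_sum.
have -> : (\sum_(t < M) (ln (l t) - 1)) / M%:R = log_scale - 1.
  by rewrite sumrB sumr_const card_ord mulrBl divff ?gt_eqF.
suff H : \sum_v average (fun tau => rho c v * ((l (tau c))^-1 * (late v tau)%:R)) <=
    M%:R ^+ 2 / n%:R + (\sum_v rho c v) / n%:R by lra.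
have -> : (\sum_v rho c v) / n%:R =
    rho c (entry L c) / n%:R + \sum_(v | v != entry L c) rho c v / n%:R.
  by rewrite (bigD1 (entry L c)) //= mulrDl mulr_suml.
(* The symbol of L at c is special: both of its cells are c itself, so it is always late. Its term
   is at most the largest value M^2/n of 1/l, as [remaining] is at least 1/M. Every other symbol has
   two distinct cells and contributes [rho c v] / n exactly. *)
rewrite (bigD1 (entry L c)) //= averageZ; apply: lerD; last first.
  apply: (@le_trans _ _ (\sum_(v | v != entry L c) rho c v / n%:R)); last first.
    by rewrite lerDr divr_ge0 // ltW.
  apply: ler_sum => v vc; rewrite averageZ ler_pM2l // (average_late M_gt0 (fun t => (l t)^-1)).
    have DE : #|D v| = 2%N.
      rewrite cards2; case: eqP => // -[_ e2].
      by case/eqP: vc; rewrite -(entry_row_cell L c v) /row_cell e2; case: (c).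
    rewrite (eq_bigr (fun=> n%:R^-1)) => [|t _].
      by rewrite sumr_const card_ord -[_ *+ M]mulr_natr mulfK ?gt_eqF.
    by rewrite DE /l invfM mulfVK ?gt_eqF ?exprn_gt0.
  rewrite !inE negb_or; apply/andP.
  by split; apply: contraNneq vc => ->; rewrite ?entry_row_cell ?entry_col_cell.
apply: le_trans (ler_piMl _ (rho_le1 _ _)) _.
  rewrite -(@average_const R ('I_n * 'I_n)%type M M_gt0 0); apply: ler_average => tau.
  by rewrite mulr_ge0 ?invr_ge0 ?ler0n // ltW.
apply: (@le_trans _ _ (average (fun _ : {ffun 'I_n * 'I_n -> 'I_M} => M%:R ^+ 2 / n%:R)));
  last by rewrite average_const.
apply: ler_average => tau; apply: (@le_trans _ _ (l (tau c))^-1).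
  by apply: ler_piMr; [rewrite ltW // invr_gt0|rewrite lern1 leq_b1].
rewrite /l invfM mulrC ler_pM2r ?invr_gt0 // -exprVn.
have r0' := ltW (r0 (tau c)); apply: lerXn2r; rewrite ?nnegrE ?invr_ge0 ?ler0n //.
rewrite /remaining invf_div ler_pdivrMr ?ltr0n ?subn_gt0 // ler_peMr ?ler0n //.
by rewrite ler1n subn_gt0.
Qed.

(** For each order, the products of [rho] over [late_sum] add up to at most 1 over all L. Jensen's
    inequality replaces the average of these products by the exponential of the mean logarithm,
    which [average_ln_late_sum] bounds uniformly in L. With [rho] equal to 1 this counts all
    squares, giving at most ((1+o(1)) n/e^2)^(n^2). *)
Lemma sum_latin_weight_le :
  \sum_(L : latin n) \prod_c rho c (entry L c) <=
  expR (n%:R ^+ 2 * log_scale + n%:R * M%:R ^+ 2 +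
        \sum_c (\sum_v rho c v) / n%:R - n%:R ^+ 2).
Proof.
set B := (X in expR X).
have nR : 0 < n%:R :> R by rewrite ltr0n.
have BE : B = \sum_(c : 'I_n * 'I_n) (log_scale + M%:R ^+ 2 / n%:R + (\sum_v rho c v) / n%:R - 1).
  have sum_cst (x : R) : \sum_(c : 'I_n * 'I_n) x = n%:R ^+ 2 * x.
    by rewrite sumr_const card_prod card_ord -[LHS]mulr_natl natrM expr2.
  rewrite !big_split /= !sum_cst /B.
  by field; rewrite gt_eqF.
rewrite -[leRHS]mul1r -ler_pdivrMr ?expR_gt0 // -expRN mulr_suml.
pose y (L : latin n) (tau : {ffun 'I_n * 'I_n -> 'I_M}) : R :=
  \sum_c (ln (rho c (entry L c)) - ln (late_sum rho L tau c)).
apply: (@le_trans _ _ (\sum_(L : latin n) average (fun tau => expR (y L tau)))).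
  apply: ler_sum => L _; apply: le_trans (expR_average M_gt0 _).
  have -> : \prod_c rho c (entry L c) = expR (\sum_c ln (rho c (entry L c))).
    by rewrite expR_sum; apply: eq_bigr => c _; rewrite lnK ?posrE.
  rewrite -expRD ler_expR average_sum BE -sumrB; apply: ler_sum => c _.
  rewrite averageD average_const // lerD2l.
  rewrite (@eq_average _ _ _ _ (fun tau => -1 * ln (late_sum rho L tau c))) ?averageZ =>
    [|tau]; last by rewrite mulN1r.
  by rewrite mulN1r lerN2 average_ln_late_sum.
rewrite -average_sum -[leRHS](@average_const R ('I_n * 'I_n)%type M M_gt0).
apply: ler_average => tau; apply: le_trans (sum_latin_weight_le1 rho_gt0 tau).
apply: ler_sum => L _; rewrite expR_sum le_eqVlt; apply/orP; left; apply/eqP.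
apply: eq_bigr => c _.
by rewrite expRB !lnK ?posrE ?late_sum_gt0.
Qed.
End LatinCount.

(** * Large deviations for a random Latin square *)

Section Deviation.
Variable R : realType.

Lemma ln_fact_ge n : n%:R * ln n%:R - n%:R <= ln (n`!%:R) :> R.
Proof.
elim: n => [|[|n] IH]; first by rewrite fact0 ln1 mul0r subr0.
  by rewrite (_ : 1`! = 1%N) // !mulr1n ln1 mulr0 sub0r oppr_le0 ler01.
rewrite factS natrM lnM ?posrE ?ltr0n ?fact_gt0 //.
have a0 : 0 < n.+1%:R :> R by rewrite ltr0n.
have := @ln_le_tangent R n.+2%:R n.+1%:R; rewrite ltr0n => /(_ isT a0).
rewrite -(ler_pM2l a0) => H.
have E : n.+1%:R * (ln n.+1%:R + n.+2%:R / n.+1%:R - 1) = n.+1%:R * ln n.+1%:R + 1 :> R.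
  rewrite -[n.+2%:R]natr1; move: (ln _) a0; move: (n.+1%:R) => a l a0.
  by field; rewrite gt_eqF.
rewrite {}E in H; move: IH H; rewrite -[n.+2%:R]natr1.
set l1 := ln (_ + 1); set l0 := ln n.+1%:R; set lf := ln _.
by move: (n.+1%:R) => a; lra.
Qed.

Lemma ln_fact_le n : (0 < n)%N ->
  ln (n`!%:R) <= (n%:R + 1) * ln n%:R - n%:R + 1 :> R.
Proof.
elim: n => [//|[_ _|n IH _]]; first by rewrite (_ : 1`! = 1%N) // !mulr1n ln1 mulr0; lra.
rewrite factS natrM lnM ?posrE ?ltr0n ?fact_gt0 //.
have a0 : 0 < n.+2%:R :> R by rewrite ltr0n.
have := @ln_le_tangent R n.+1%:R n.+2%:R; rewrite ltr0n => /(_ isT a0).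
rewrite -(ler_pM2l a0) => H.
have E : n.+2%:R * (ln n.+2%:R + n.+1%:R / n.+2%:R - 1) = n.+2%:R * ln n.+2%:R - 1 :> R.
  move: (ln _) a0; rewrite -[n.+2%:R]natr1; move: (n.+1%:R) => a l a0.
  by field; rewrite gt_eqF.
rewrite {}E in H; move: (IH isT) H; rewrite -[n.+2%:R]natr1.
set l1 := ln (_ + 1); set l0 := ln n.+1%:R; set lf := ln _.
by move: (n.+1%:R) => a; lra.
Qed.

(** The sum over t is a Riemann sum for the integral of 2 ln x over [0, 1], which is -2; the error
    for finite M is read off from ln M!. *)
Lemma log_scale_le n M : (0 < n)%N -> (0 < M)%N ->
  log_scale R n M <= ln n%:R - 2 + 2 * (ln M%:R + 1) / M%:R.
Proof.
move=> n0 M0; have nR : 0 < n%:R :> R by rewrite ltr0n.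
have MR : 0 < M%:R :> R by rewrite ltr0n.
rewrite /log_scale ler_pdivrMr //.
have -> : \sum_(t < M) ln (n%:R * remaining R t ^+ 2) =
    M%:R * ln n%:R + 2 * (ln (M`!%:R) - M%:R * ln M%:R) :> R.
  rewrite (eq_bigr (fun t : 'I_M => ln n%:R + 2 * (ln (M - t)%:R - ln M%:R))); last first.
    move=> t _; have tM : 0 < (M - t)%:R :> R by rewrite ltr0n subn_gt0.
    rewrite lnM ?posrE ?exprn_gt0 ?remaining_gt0 // lnXn ?remaining_gt0 //.
    by rewrite /remaining ln_div ?posrE // mulr2n mulrDl mul1r.
  rewrite big_split /= sumr_const card_ord -mulr_sumr sumrB sumr_const card_ord.
  rewrite -(mulr_natl (ln n%:R) M) -(mulr_natl (ln M%:R) M); congr (_ + 2 * (_ - _)).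
  rewrite -ffactnn ffact_prod natr_prod.
  have : forall r : seq 'I_M, \sum_(t <- r) ln (M - t)%:R = ln (\prod_(t <- r) (M - t)%:R) :> R.
    elim=> [|t r IH]; first by rewrite !big_nil ln1.
    rewrite !big_cons IH lnM ?posrE ?ltr0n ?subn_gt0 //.
    by apply: prodr_gt0 => u _; rewrite ltr0n subn_gt0.
  by apply.
rewrite [leRHS]mulrDl divfK ?gt_eqF //.
by have := ln_fact_le M0; move: (M%:R) => m; lra.
Qed.

Lemma card_latin_ge_expR n : (0 < n)%N ->
  expR (n%:R ^+ 2 * (ln n%:R - 2)) <= #|latin n|%:R :> R.
Proof.
move=> n0; have nR : 0 < n%:R :> R by rewrite ltr0n.
have := card_latin_ge n; rewrite -(ler_nat R) natrM !natrX => H.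
have nn : 0 < n%:R ^+ (n * n) :> R by rewrite exprn_gt0.
rewrite -(ler_pM2l nn); apply: le_trans H.
have -> : n%:R ^+ (n * n) = expR (ln n%:R *+ (n * n)) :> R.
  by rewrite -lnXn // lnK ?posrE.
have -> : n`!%:R ^+ (2 * n) = expR (ln n`!%:R *+ (2 * n)) :> R.
  by rewrite -lnXn ?lnK ?posrE ?exprn_gt0 ?ltr0n ?fact_gt0.
rewrite -expRD ler_expR -[_ *+ (n * n)]mulr_natl -[_ *+ (2 * n)]mulr_natl !natrM.
have := ln_fact_ge n; rewrite -(ler_pM2l nR); move: (ln n`!%:R) (ln n%:R) => f l; move: (n%:R) => a.
by nra.
Qed.

(** The upper bound for the weighted count is compared with the lower bound for the plain count, and
    the terms n^2 (ln n - 2) cancel. Each triple of E leaves a gain of 1/(2n) in the exponent, since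
    1/e <= 1/2. *)
Lemma sum_expR_deviation n M (E : 'I_n * 'I_n -> 'I_n -> bool) :
  (0 < n)%N -> (0 < M)%N ->
  \sum_(L : latin n) expR (- (\sum_c E c (entry L c))%:R) <=
  #|latin n|%:R * expR (n%:R ^+ 2 * (2 * (ln M%:R + 1) / M%:R) + n%:R * M%:R ^+ 2
     - (\sum_c \sum_v E c v)%:R / (2 * n%:R)) :> R.
Proof.
move=> n0 M0; have nR : 0 < n%:R :> R by rewrite ltr0n.
(* Triples of [E] get weight [1/e], so that a square pays [1/e] for each. *)
pose rho c v : R := expR (- (E c v)%:R).
have rho0 c v : 0 < rho c v by apply: expR_gt0.
have rho1 c v : rho c v <= 1 by rewrite expR_le1 oppr_le0.
have rhoE c v : rho c v <= 1 - (E c v)%:R / 2.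
  rewrite /rho; case: (E c v); rewrite ?oppr0 ?expR0 ?mul0r ?subr0 //=.
  have := expR_ge1Dx (1 : R); rewrite expRN => H.
  rewrite (_ : 1 - 1 / 2 = 2^-1) ?lef_pV2 ?posrE ?expR_gt0 //; last by field.
have := sum_latin_weight_le rho0 rho1 n0 M0.
rewrite (eq_bigr (fun L => expR (- (\sum_c E c (entry L c))%:R))) => [H|L _]; last first.
  by rewrite natr_sum -sumrN expR_sum.
apply: le_trans H _; apply: le_trans (ler_wpM2r (expR_ge0 _) (card_latin_ge_expR n0)).
rewrite -expRD ler_expR.
have Hr : \sum_c (\sum_v rho c v) / n%:R <=
   n%:R ^+ 2 - (\sum_c \sum_v E c v)%:R / (2 * n%:R) :> R.
  rewrite -mulr_suml ler_pdivrMr // mulrBl.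
  have -> : (\sum_c \sum_v E c v)%:R / (2 * n%:R) * n%:R = \sum_c \sum_v (E c v)%:R / 2 :> R.
    rewrite natr_sum invfM mulrA mulfVK ?gt_eqF // mulr_suml; apply: eq_bigr => c _.
    by rewrite natr_sum mulr_suml.
  apply: (@le_trans _ _ (\sum_(c : 'I_n * 'I_n) \sum_(v < n) (1 - (E c v)%:R / 2))).
    by apply: ler_sum => c _; apply: ler_sum => v _.
  rewrite le_eqVlt; apply/orP; left; apply/eqP.
  under eq_bigr do rewrite sumrB sumr_const card_ord.
  by rewrite sumrB sumr_const card_prod card_ord -(mulr_natl _ (n * n)) natrM expr2.
have := log_scale_le n0 M0.
have n2 : 0 < n%:R ^+ 2 :> R by rewrite exprn_gt0.
rewrite -(ler_pM2l n2) !mulrDr; lra.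
Qed.

Lemma log_correction_small (e : R) : 0 < e ->
  exists2 M, (0 < M)%N & 2 * (ln M%:R + 1) / M%:R <= e.
Proof.
(* For M = k^2 and ln k < k, the numerator 2 (ln M + 1) is at most 4k + 2 <= 6k, so the quotient is
   at most 6/k. *)
move=> e0; pose k := (Num.bound (6 / e)).+1.
have k0 : 0 < k%:R :> R by rewrite ltr0n.
have k1 : 1 <= k%:R :> R by rewrite ler1n.
have ke : 6 <= e * k%:R.
  rewrite mulrC -ler_pdivrMr // ltW // (lt_trans (archi_boundP _)) ?ltr_nat //.
  by rewrite divr_ge0 // ltW.
exists (k ^ 2)%N; first by rewrite expn_gt0.
rewrite natrX ler_pdivrMr ?exprn_gt0 // lnXn // mulr2n.
have := ln_sublinear k0; move: (ln _) => l lk.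
have : 6 * k%:R <= e * k%:R * k%:R by rewrite ler_pM2r.
rewrite expr2 mulrA; move: (e * k%:R * k%:R) => x; lra.
Qed.

Lemma latin_deviation (c : R) : 0 < c -> exists (kappa c' : R) (N : nat),
  [/\ 0 < kappa, 0 < c' & forall n (E : 'I_n * 'I_n -> 'I_n -> bool), (N <= n)%N ->
    c * n%:R ^+ 3 <= (\sum_x \sum_v E x v)%:R ->
    #|[set L : latin n | (\sum_x E x (entry L x))%:R <= kappa * n%:R ^+ 2]|%:R <=
    #|latin n|%:R * expR (- c' * n%:R ^+ 2)].
Proof.
move=> c0; have [M M0 HM] : exists2 M, (0 < M)%N & 2 * (ln M%:R + 1) / M%:R <= c / 8.
  by apply: log_correction_small; lra.
(* Exponents per n^2: c/8 from the correction in M, c/16 from n M^2 for large n, c/16 from Markov's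
   inequality at the threshold [kappa], and the gain -c/2 from E; the sum is -c/4. *)
exists (c / 16), (c / 4), (Num.bound (16 * M%:R ^+ 2 / c)).+1; split; try lra.
move=> n E Nn HE; have n0 : (0 < n)%N by apply: leq_trans Nn.
have nR : 0 < n%:R :> R by rewrite ltr0n.
set S := [set L | _].
have nM : n%:R * M%:R ^+ 2 <= n%:R ^+ 2 * (c / 16).
  rewrite expr2 -mulrA ler_pM2l //.
  have H : 16 * M%:R ^+ 2 / c <= n%:R.
    rewrite ltW // (lt_le_trans (archi_boundP _)) ?ler_nat ?(ltnW Nn) //.
    by rewrite divr_ge0 ?(ltW c0) // mulr_ge0 // exprn_ge0.
  move: H; rewrite ler_pdivrMr //; lra.
have E2 : n%:R ^+ 2 * (c / 2) <= (\sum_x \sum_v E x v)%:R / (2 * n%:R).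
  rewrite ler_pdivlMr ?mulr_gt0 //; apply: le_trans HE.
  by rewrite le_eqVlt; apply/orP; left; apply/eqP; field.
have := sum_expR_deviation E n0 M0.
rewrite (bigID (mem S)) /= => H.
have {H} H1 : #|S|%:R * expR (- (c / 16 * n%:R ^+ 2)) <=
   #|latin n|%:R * expR (n%:R ^+ 2 * (2 * (ln M%:R + 1) / M%:R) + n%:R * M%:R ^+ 2
     - (\sum_x \sum_v E x v)%:R / (2 * n%:R)).
  apply: le_trans H; rewrite -[leLHS]addr0; apply: lerD; last first.
    by apply: sumr_ge0 => L _; apply: expR_ge0.
  rewrite mulr_natl -sumr_const; apply: ler_sum => L; rewrite inE => HL.
  by rewrite ler_expR lerN2.
rewrite -(ler_pM2r (expR_gt0 (- (c / 16 * n%:R ^+ 2)))); apply: le_trans H1 _.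
rewrite -[leRHS]mulrA -expRD ler_wpM2l // ler_expR.
have n2 : 0 < n%:R ^+ 2 :> R by rewrite exprn_gt0.
have := HM; rewrite -(ler_pM2l n2).
set a := _ * (2 * _ / _); move: nM E2; set b := _ / (2 * _); set d := n%:R * _; lra.
Qed.
End Deviation.

(** * Vertex links are unions of random permutations *)

Section RandomPermutation.
Variables (R : realFieldType) (n : nat) (W : {set 'I_n}).

Definition perms_into (T : {set 'I_n}) : {set 'S_n} :=
  [set s : 'S_n | [forall x in T, s x \in W]].

Lemma card_perms_into_sub (T : {set 'I_n}) (s : 'S_n) : s \in perms_into T ->
  #|[set y | (y \notin T) && (s y \in W)]| = (#|W| - #|T|)%N.
Proof.
rewrite inE => /forall_inP sT.
have -> : [set y | (y \notin T) && (s y \in W)] = (s @^-1: W) :\: T.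
  by apply/setP => y; rewrite !inE.
rewrite cardsD (setIidPr _); last by apply/subsetP => x /sT; rewrite inE.
by rewrite (card_preimset _ (@perm_inj _ s)).
Qed.

(** Given that s maps T into W, symmetry among the points outside T shows that s y lies in W with
    probability (#|W| - #|T|) / (n - #|T|), which is at most #|W| / n. *)
Lemma card_perms_into_step (T : {set 'I_n}) (y : 'I_n) : y \notin T ->
  (#|perms_into (y |: T)| * n <= #|perms_into T| * #|W|)%N.
Proof.
move=> yT.
have sub1 z s : (s \in perms_into (z |: T)) = (s \in perms_into T) && (s z \in W).
  rewrite !inE; apply/forall_inP/andP => [H|[/forall_inP H zW] x].
    by split; [apply/forall_inP => x xT|]; apply: H; rewrite !inE ?eqxx // xT orbT.
  by rewrite !inE => /orP[/eqP ->|/H].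
have same z : z \notin T -> #|perms_into (z |: T)| = #|perms_into (y |: T)|.
  move=> zT; rewrite -(card_imset (mem (perms_into (z |: T))) (@mulgI _ (tperm y z))).
  apply: eq_card => s; apply/imsetP/idP => [[r rP ->]|sP].
    move: rP; rewrite !sub1 !inE permM tpermL => /andP[/forall_inP H ->]; rewrite andbT.
    apply/forall_inP => x xT; rewrite permM tpermD ?H //.
      by apply: contraNneq yT => ->.
    by apply: contraNneq zT => ->.
  exists (tperm y z * s)%g; last by rewrite mulgA tperm2 mul1g.
  move: sP; rewrite !sub1 !inE permM tpermR => /andP[/forall_inP H ->]; rewrite andbT.
  apply/forall_inP => x xT; rewrite permM tpermD ?H //.
    by apply: contraNneq yT => ->.
  by apply: contraNneq zT => ->.
have count : (#|perms_into (y |: T)| * (n - #|T|) = #|perms_into T| * (#|W| - #|T|))%N.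
  have -> : (n - #|T|)%N = #|~: T| by rewrite [RHS]cardsCs setCK card_ord.
  rewrite mulnC -sum_nat_const.
  transitivity (\sum_(z in ~: T) \sum_(s in perms_into T) (s z \in W))%N.
    apply: eq_bigr => z; rewrite inE => zT; rewrite -(same z zT) -sum1_card.
    by rewrite (eq_bigl _ _ (sub1 z)) big_mkcondr /=; apply: eq_bigr => s _; case: (_ \in W).
  rewrite exchange_big /= -sum_nat_const; apply: eq_bigr => s sT.
  rewrite -(card_perms_into_sub sT) -sum1_card big_mkcond [RHS]big_mkcond /=.
  by apply: eq_bigr => z _; rewrite !inE; case: (z \in T) => //=; case: (_ \in W).
have Wn : (#|W| <= n)%N by rewrite -[X in (_ <= X)%N]card_ord max_card.
have Tn : (#|T| < n)%N.
  rewrite -[X in (_ < X)%N]card_ord -cardsT proper_card // properT.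
  by apply: contraNneq yT => ->; rewrite inE.
move: (#|T|) (#|W|) (#|perms_into _|) (#|perms_into _|) count Wn Tn => t w a b count Wn Tn.
rewrite -(@leq_pmul2r (n - t)) ?subn_gt0 //.
rewrite mulnAC count -!mulnA leq_mul2l; apply/orP; right.
by rewrite mulnC !mulnBr [(w * n)%N]mulnC leq_sub2l // leq_mul2r Wn orbT.
Qed.

(** Write theta^[s y in W] as 1 + (theta - 1) [s y in W]. The second term imposes one more condition
    on s, so the induction has to allow arbitrary T. The outcome is the moment bound of independent
    trials with probability #|W|/n. *)
Lemma sum_exp_perms_into (theta : R) (T : {set 'I_n}) (r : seq 'I_n) :
  1 <= theta -> uniq r -> {in r, forall x, x \notin T} ->
  \sum_(s in perms_into T) theta ^+ count (fun x => s x \in W) r <=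
  #|perms_into T|%:R * (1 + (theta - 1) * #|W|%:R / n%:R) ^+ size r.
Proof.
move=> t1; elim: r T => [|y r IH] T /=.
  by move=> _ _; rewrite expr0 mulr1 sumr_const.
move=> /andP[yr ur] rT; have yT : y \notin T by apply: rT; rewrite mem_head.
have n0 : 0 < n%:R :> R by rewrite ltr0n; case: (n) y {yr rT yT} => // -[].
set K := (1 + _).
have t0 : 0 <= theta - 1 by rewrite subr_ge0.
have K0 : 0 <= K by rewrite addr_ge0 // divr_ge0 // mulr_ge0.
have -> : \sum_(s in perms_into T) theta ^+ ((s y \in W) + count (fun x => s x \in W) r) =
   \sum_(s in perms_into T) theta ^+ count (fun x => s x \in W) r +
   (theta - 1) * \sum_(s in perms_into (y |: T)) theta ^+ count (fun x => s x \in W) r.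
  have sub1 s : (s \in perms_into (y |: T)) = (s \in perms_into T) && (s y \in W).
    rewrite !inE; apply/forall_inP/andP => [H|[/forall_inP H zW] x].
      by split; [apply/forall_inP => x xT|]; apply: H; rewrite !inE ?eqxx // xT orbT.
    by rewrite !inE => /orP[/eqP ->|/H].
  rewrite (eq_bigl _ _ sub1) big_mkcondr mulr_sumr -big_split /=; apply: eq_bigr => s _.
  by case: (_ \in W); rewrite ?add0n ?mulr0 ?addr0 // exprD expr1 mulrBl mul1r addrC subrK.
have H1 := IH T ur (fun x xr => rT x (mem_behead (s := y :: r) xr)).
have H2 : \sum_(s in perms_into (y |: T)) theta ^+ count (fun x => s x \in W) r <=
    #|perms_into (y |: T)|%:R * K ^+ size r.
  apply: IH => // x xr; rewrite !inE negb_or rT ?inE ?xr ?orbT // andbT.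
  by apply: contraNneq yr => <-.
apply: le_trans (lerD H1 (ler_wpM2l t0 H2)) _.
have step : #|perms_into (y |: T)|%:R <= #|perms_into T|%:R * #|W|%:R / n%:R :> R.
  by rewrite ler_pdivlMr // -!natrM ler_nat card_perms_into_step.
rewrite mulrA -mulrDl exprS mulrA ler_wpM2r ?exprn_ge0 //.
rewrite /K mulrDr mulr1 lerD2l; apply: le_trans (ler_wpM2l t0 step) _.
by rewrite le_eqVlt; apply/orP; left; apply/eqP; ring.
Qed.

Lemma sum_exp_perm (theta : R) (U : {set 'I_n}) : 1 <= theta ->
  \sum_(s : 'S_n) theta ^+ #|[set x in U | s x \in W]| <=
  n`!%:R * (1 + (theta - 1) * #|W|%:R / n%:R) ^+ #|U|.
Proof.
move=> t1; have := @sum_exp_perms_into theta set0 (enum U) t1 (enum_uniq _).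
have -> : perms_into set0 = setT.
  by apply/setP => s; rewrite !inE; apply/forall_inP => x; rewrite inE.
rewrite cardsT card_Sn -cardE => /(_ _)H; apply: le_trans (H _) => [|x _]; last by rewrite inE.
rewrite le_eqVlt; apply/orP; left; apply/eqP; apply: eq_big => [s|s _]; first by rewrite inE.
rewrite -size_filter; congr (_ ^+ _); rewrite cardE; apply/perm_size/uniq_perm.
- exact: enum_uniq.
- by rewrite filter_uniq ?enum_uniq.
by move=> x; rewrite mem_enum mem_filter mem_enum inE andbC.
Qed.
End RandomPermutation.

(** * Symmetries of Latin squares and uniformity of the links *)

Section Equivariance.
Variable n : nat.

(** Ensures that [lk] of a uniform Latin square is a uniform permutation, see [sum_equivariant].
    Relabelling the symbols supplies [act] for the links of rows and columns, permuting the columns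
    for the links of symbols. *)
Definition equivariant (lk : latin n -> 'S_n) : Prop :=
  exists act : 'S_n -> latin n -> latin n,
    (forall rho, injective (act rho)) /\
    (forall rho L, lk (act rho L) = (lk L * rho)%g).

Lemma sum_equivariant (R : numFieldType) (lk : latin n -> 'S_n) (F : 'S_n -> R) :
  equivariant lk ->
  n`!%:R * \sum_L F (lk L) = #|latin n|%:R * \sum_s F s.
Proof.
move=> [act [act_inj lk_act]].
transitivity (\sum_(rho : 'S_n) \sum_L F (lk (act rho L))).
  rewrite [RHS](eq_bigr (fun=> \sum_L F (lk L))) => [|rho _].
    by rewrite sumr_const card_Sn mulr_natl.
  by rewrite [RHS](reindex_inj (act_inj rho)).
rewrite exchange_big /= mulr_natl -sumr_const; apply: eq_bigr => L _.
rewrite [RHS](reindex_inj (@mulgI _ (lk L))) /=.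
by apply: eq_bigr => rho _; rewrite lk_act.
Qed.

Lemma is_latinP (f : {ffun 'I_n -> 'S_n}) :
  (forall i i' x, f i x = f i' x -> i = i') -> is_latin f.
Proof.
move=> H; apply/forallP => i; apply/forallP => j; apply/implyP => ij.
apply/forallP => x; apply/negP => /eqP e; move: ij.
by rewrite (H i j (((f j)^-1)%g x)) ?ltnn // e permKV.
Qed.

Lemma latin_mulr_proof (L : latin n) (rho : 'S_n) :
  is_latin [ffun i => (val L i * rho)%g].
Proof.
by apply: is_latinP => i i' x; rewrite !ffunE !permM => /perm_inj /latin_row_inj.
Qed.

Definition latin_mulr (rho : 'S_n) (L : latin n) : latin n :=
  exist (fun f => is_true (is_latin f)) _ (latin_mulr_proof L rho).

Lemma latin_mull_proof (L : latin n) (rho : 'S_n) :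
  is_latin [ffun i => (rho^-1 * val L i)%g].
Proof.
by apply: is_latinP => i i' x; rewrite !ffunE !permM => /latin_row_inj.
Qed.

Definition latin_mull (rho : 'S_n) (L : latin n) : latin n :=
  exist (fun f => is_true (is_latin f)) _ (latin_mull_proof L rho).

Lemma latin_mulr_inj rho : injective (latin_mulr rho).
Proof.
move=> L L' /(congr1 val) /= /ffunP e; apply/val_inj/ffunP => i.
by have := e i; rewrite !ffunE => /mulIg.
Qed.

Lemma latin_mull_inj rho : injective (latin_mull rho).
Proof.
move=> L L' /(congr1 val) /= /ffunP e; apply/val_inj/ffunP => i.
by have := e i; rewrite !ffunE => /mulgI.
Qed.

Lemma symbol_perm_proof (L : latin n) (l : 'I_n) :
  injective (fun i => ((val L i)^-1)%g l).
Proof.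
move=> i i' e; apply: (@latin_row_inj _ L i i' (((val L i)^-1)%g l)).
by rewrite /entry /= permKV e permKV.
Qed.

Definition symbol_perm (L : latin n) (l : 'I_n) : 'S_n := perm (@symbol_perm_proof L l).

Lemma row_equivariant i : equivariant (fun L => val L i).
Proof.
exists latin_mulr; split; first exact: latin_mulr_inj.
by move=> rho L; rewrite /= ffunE.
Qed.

Lemma col_equivariant j : equivariant (fun L => col_perm L j).
Proof.
exists latin_mulr; split; first exact: latin_mulr_inj.
by move=> rho L; apply/permP => i; rewrite permM !permE /= ffunE permM.
Qed.

Lemma symbol_equivariant l : equivariant (fun L => symbol_perm L l).
Proof.
exists latin_mull; split; first exact: latin_mull_inj.
move=> rho L; apply/permP => i; rewrite permM ![symbol_perm _ _ _]permE.
by rewrite [val (latin_mull _ _) i]ffunE invMg invgK permM.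
Qed.

End Equivariance.

Section LinkTail.
Variables (R : realFieldType) (n d : nat) (lk : latin n -> 'S_n).
Hypothesis lk_equiv : equivariant lk.

Definition link_edges (Ls : {ffun 'I_d -> latin n}) (U W : {set 'I_n}) : nat :=
  \sum_(k < d) #|[set x in U | lk (Ls k) x \in W]|.

Lemma sum_exp_link_edges (theta : R) (U W : {set 'I_n}) : 1 <= theta ->
  \sum_Ls theta ^+ link_edges Ls U W <=
  #|latin n|%:R ^+ d * (1 + (theta - 1) * #|W|%:R / n%:R) ^+ (#|U| * d).
Proof.
move=> t1; pose X (s : 'S_n) : R := theta ^+ #|[set x in U | s x \in W]|.
rewrite (eq_bigr (fun Ls : {ffun 'I_d -> latin n} => \prod_(k < d) X (lk (Ls k)))) => [|Ls _]; last first.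
  by rewrite /link_edges expr_sum.
rewrite -(bigA_distr_bigA (fun _ L => X (lk L))) prodr_const card_ord exprM -exprMn.
apply: lerXn2r; rewrite ?nnegrE.
- by apply: sumr_ge0 => L _; rewrite exprn_ge0 // (le_trans ler01).
- rewrite mulr_ge0 ?exprn_ge0 // addr_ge0 // divr_ge0 // mulr_ge0 // subr_ge0 //.
have nf : 0 < n`!%:R :> R by rewrite ltr0n fact_gt0.
rewrite -(ler_pM2l nf) (sum_equivariant X lk_equiv) mulrCA ler_wpM2l //.
exact: sum_exp_perm.
Qed.

Lemma link_edges_tail (theta : R) (m : nat) (U W : {set 'I_n}) : 1 <= theta ->
  #|[set Ls | (m <= link_edges Ls U W)%N]|%:R * theta ^+ m <=
  #|latin n|%:R ^+ d * (1 + (theta - 1) * #|W|%:R / n%:R) ^+ (#|U| * d).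
Proof.
move=> t1; apply: le_trans (sum_exp_link_edges U W t1).
rewrite mulr_natl -sumr_const big_mkcond; apply: ler_sum => Ls _; rewrite inE.
case: ifP => [mL|_]; last by rewrite exprn_ge0 // (le_trans ler01).
exact: ler_weXn2l.
Qed.

End LinkTail.

(** * Edge counts in a union of random permutations *)

Lemma expnn_le_fact (R : realType) s : s%:R ^+ s <= 4 ^+ s * s`!%:R :> R.
Proof.
case: s => [|s]; first by rewrite !expr0 mul1r.
have s0 : 0 < s.+1%:R :> R by rewrite ltr0n.
have f0 : 0 < (s.+1)`!%:R :> R by rewrite ltr0n fact_gt0.
rewrite -ler_ln ?posrE ?mulr_gt0 ?exprn_gt0 // lnM ?posrE ?exprn_gt0 // !lnXn //.
have ln2 : 2^-1 <= ln 2 :> R.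
  by have := @ln_le_tangent R 1 2 ltr01 (ltr0Sn R 1); rewrite ln1; lra.
have -> : ln 4 = 2 * ln 2 :> R.
  by rewrite (_ : 4 = 2 ^+ 2 :> R) ?lnXn ?mulr_natl //; ring.
have := ln_fact_ge R s.+1; move: ln2.
rewrite -(ler_pM2l s0) -(mulr_natl (ln s.+1%:R)) -(mulr_natl (2 * _)).
set a := s.+1%:R; set l := ln 2; set l' := ln a; set f := ln _; lra.
Qed.

Lemma bin_le_expn (R : realType) N s : (0 < s)%N ->
  'C(N, s)%:R <= (4 * N%:R / s%:R) ^+ s :> R.
Proof.
move=> s0; have sR : 0 < s%:R :> R by rewrite ltr0n.
have f0 : 0 < s`!%:R :> R by rewrite ltr0n fact_gt0.
rewrite expr_div_n ler_pdivlMr ?exprn_gt0 //.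
apply: le_trans (ler_wpM2l (ler0n _ _) (expnn_le_fact R s)) _.
rewrite mulrCA exprMn ler_wpM2l ?exprn_ge0 // -natrM -natrX ler_nat bin_ffact.
have [Ns|sN] := ltnP N s; first by rewrite ffact_small.
rewrite ffact_prod -[X in (_ <= _ ^ X)%N](card_ord s) -prod_nat_const.
by apply: leq_prod => i _; apply: leq_subr.
Qed.

(** After cancelling one n, it suffices that s^s <= (2s)^(s-1), that is s <= 2^(s-1). Equality at s
    = 1 shows that single vertices govern the failure probability for small sets. *)
Lemma expr_ratio_le (R : realFieldType) s n : (0 < s)%N -> (2 * s <= n)%N ->
  (s%:R / n%:R) ^+ s <= n%:R^-1 :> R.
Proof.
move=> s0 sn; have n0 : (0 < n)%N by lia.
have nR : 0 < n%:R :> R by rewrite ltr0n.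
rewrite expr_div_n ler_pdivrMr ?exprn_gt0 //.
case: s s0 sn => // s _ sn; rewrite [n%:R ^+ _]exprS mulKf ?gt_eqF //.
apply: (@le_trans _ _ ((2 * s.+1)%:R ^+ s)); last by rewrite lerXn2r ?nnegrE ?ler_nat.
rewrite -!natrX ler_nat expnMn expnS leq_mul2r; apply/orP; right.
exact: ltn_expl.
Qed.

Section LinkUnion.
Variables (R : realType) (n d p q : nat) (delta : R) (lk : latin n -> 'S_n).
Hypothesis lk_equiv : equivariant lk.

(* A set of vertices of a link is encoded as a set in ['I_n + 'I_n]. *)
Definition left_part (A : {set 'I_n + 'I_n}) : {set 'I_n} := [set x | inl x \in A].
Definition right_part (A : {set 'I_n + 'I_n}) : {set 'I_n} := [set x | inr x \in A].

Lemma card_parts (A : {set 'I_n + 'I_n}) : #|A| = (#|left_part A| + #|right_part A|)%N.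
Proof.
rewrite -sum1_card big_mkcond /= big_sumType /=; congr (_ + _)%N;
by rewrite -big_mkcond /= -sum1_card; apply: eq_bigl => x; rewrite inE.
Qed.

Definition edges_in (Ls : {ffun 'I_d -> latin n}) A : nat :=
  link_edges lk Ls (left_part A) (right_part A).

Lemma edges_in_le_left Ls A : (edges_in Ls A <= d * #|left_part A|)%N.
Proof.
rewrite -[X in (_ <= X * _)%N]card_ord -sum_nat_const; apply: leq_sum => k _.
by apply/subset_leq_card/subsetP => x; rewrite inE => /andP[].
Qed.

Lemma edges_in_le_right Ls A : (edges_in Ls A <= d * #|right_part A|)%N.
Proof.
rewrite -[X in (_ <= X * _)%N]card_ord -sum_nat_const; apply: leq_sum => k _.
rewrite -(card_imset _ (@perm_inj _ (lk (Ls k)))); apply/subset_leq_card/subsetP => _ /imsetP[x + ->].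
by rewrite inE => /andP[].
Qed.

(** Markov's inequality with theta = n/#|A|: this keeps the base of the moment bound at most 2,
    while the threshold contributes theta^(q #|A|). *)
Lemma small_edges_tail (A : {set 'I_n + 'I_n}) : (0 < #|A| <= n)%N ->
  #|[set Ls | (q * #|A| <= edges_in Ls A)%N]|%:R <=
  #|latin n|%:R ^+ d * (2 ^+ d * (#|A|%:R / n%:R) ^+ q) ^+ #|A| :> R.
Proof.
move=> /andP[s0 sn]; set s := #|A| in s0 sn *.
have sR : 0 < s%:R :> R by rewrite ltr0n.
have nR : 0 < n%:R :> R by rewrite ltr0n (leq_trans s0).
have t1 : 1 <= n%:R / s%:R :> R by rewrite ler_pdivlMr // mul1r ler_nat.
have := link_edges_tail d lk_equiv (q * s) (left_part A) (right_part A) t1.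
have tp : 0 < (n%:R / s%:R) ^+ (q * s) :> R by rewrite exprn_gt0 // divr_gt0.
rewrite -ler_pdivlMr // => /le_trans; apply.
have -> : (2 ^+ d * (s%:R / n%:R) ^+ q) ^+ s = 2 ^+ (s * d) / (n%:R / s%:R) ^+ (q * s) :> R.
  by rewrite exprMn -!exprM [(s * d)%N]mulnC -exprVn invf_div.
rewrite mulrA ler_wpM2r ?invr_ge0 ?(ltW tp) // ler_wpM2l ?exprn_ge0 //.
have wn : #|right_part A|%:R <= s%:R :> R by rewrite ler_nat /s card_parts leq_addl.
apply: (@le_trans _ _ (2 ^+ (#|left_part A| * d))).
  apply: lerXn2r; rewrite ?nnegrE //.
    by rewrite addr_ge0 // divr_ge0 // mulr_ge0 // subr_ge0.
  have : (n%:R / s%:R - 1) * #|right_part A|%:R / n%:R <= 1 :> R; last by lra.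
  rewrite ler_pdivrMr // mul1r mulrBl mul1r mulrAC.
  apply: (@le_trans _ _ (n%:R * #|right_part A|%:R / s%:R)).
    by rewrite lerBlDr lerDl.
  by rewrite ler_pdivrMr // ler_wpM2l.
apply: ler_weXn2l; first by lra.
by rewrite leq_mul2r /s card_parts leq_addr orbT.
Qed.
End LinkUnion.

Lemma expr31_20_le (R : realFieldType) : (31 / 20) ^+ 11 <= 2 ^+ 8 :> R.
Proof. by rewrite !exprS expr0; lra. Qed.

Section LinkUnion.
Variables (R : realType) (n d p q : nat) (delta : R) (lk : latin n -> 'S_n).
Hypothesis lk_equiv : equivariant lk.
Hypothesis dE : d = (20 * p)%N.

(** Each vertex of A has d = 20p edges, so more than 9p #|A| edges inside A force more than 9/20 of
    A, hence at most 11/20, onto each side. The moment bound with theta = 2 is then (1 + 11/20)^(11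
    p #|A|) <= 2^(8 p #|A|), against the threshold 2^(9 p #|A|). *)
Lemma large_edges_tail (A : {set 'I_n + 'I_n}) : (0 < #|A| <= n)%N ->
  #|[set Ls : {ffun 'I_d -> latin n} | (9 * p * #|A| < edges_in lk Ls A)%N]|%:R <=
  #|latin n|%:R ^+ d / 2 ^+ (p * #|A|) :> R.
Proof.
move=> /andP[s0 sn]; set s := #|A| in s0 sn *; set S := [set Ls | _].
have sE : s = (#|left_part A| + #|right_part A|)%N := card_parts A.
have nR : 0 < n%:R :> R by rewrite ltr0n (leq_trans s0).
have rhs0 : 0 <= #|latin n|%:R ^+ d / 2 ^+ (p * s) :> R by rewrite divr_ge0 ?exprn_ge0.
have [small|big] := boolP [exists Ls, (Ls : {ffun 'I_d -> latin n}) \in S]; last first.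
  rewrite (_ : S = set0) ?cards0 //; apply/eqP; rewrite -subset0.
  by apply/subsetP => Ls LsS; move: big; rewrite negb_exists => /forallP/(_ Ls); rewrite LsS.
have [Ls] := existsP small; rewrite inE => eLs.
have l1 := leq_trans eLs (edges_in_le_left lk Ls A).
have l2 := leq_trans eLs (edges_in_le_right lk Ls A).
have p0 : (0 < p)%N by rewrite lt0n; apply: contraTneq l1 => p0; rewrite dE p0 muln0 mul0n.
have {l1}u9 : (9 * s < 20 * #|left_part A|)%N.
  by rewrite -(ltn_pmul2l p0); move: l1; rewrite dE; lia.
have {l2}w9 : (9 * s < 20 * #|right_part A|)%N.
  by rewrite -(ltn_pmul2l p0); move: l2; rewrite dE; lia.
have u11 : (20 * #|left_part A| <= 11 * s)%N by lia.
have w11 : (20 * #|right_part A| <= 11 * s)%N by lia.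
have := link_edges_tail d lk_equiv (9 * p * s) (left_part A) (right_part A) (ler1n R 2).
rewrite -ler_pdivlMr ?exprn_gt0 // => H; apply: le_trans (le_trans _ H) _.
  by rewrite ler_nat; apply/subset_leq_card/subsetP => Ls'; rewrite !inE => /ltnW.
rewrite -[leLHS]mulrA ler_wpM2l ?exprn_ge0 // ler_pdivrMr ?exprn_gt0 //.
have -> : (9 * p * s = p * s + 8 * (p * s))%N by lia.
rewrite exprD mulKf ?expf_neq0 ?pnatr_eq0 //.
have e1 : 2 - 1 = 1 :> R by rewrite mulr2n addrK.
have e31 : 31 / 20 = 1 + 11 / 20 :> R by field.
have wn : #|right_part A|%:R / n%:R <= 11 / 20 :> R.
  rewrite ler_pdivrMr // mulrAC ler_pdivlMr // -!natrM ler_nat mulnC.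
  by rewrite (leq_trans w11) // leq_mul2l.
rewrite e1 mul1r; apply: (@le_trans _ _ ((31 / 20) ^+ (#|left_part A| * d))).
  by apply: lerXn2r; rewrite ?nnegrE ?divr_ge0 ?addr_ge0 ?divr_ge0 // e31 lerD2l.
apply: (@le_trans _ _ ((31 / 20) ^+ (11 * (p * s)))).
  apply: ler_weXn2l; first by rewrite e31 lerDl divr_ge0.
  by rewrite dE; move: u11; rewrite -(leq_pmul2l p0); lia.
have h31 : 0 <= 31 / 20 :> R by rewrite divr_ge0.
rewrite [leLHS]exprM [leRHS]exprM; apply: lerXn2r; rewrite ?nnegrE ?exprn_ge0 //.
exact: expr31_20_le.
Qed.

(** A link has 2n vertices, so [#|A| <= n] means at most half of them. With 9p #|A| edges inside, A
    keeps 9/10 of its 20p #|A| edge ends. *)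
Definition link_bad (Ls : {ffun 'I_d -> latin n}) : bool :=
  [exists A : {set 'I_n + 'I_n},
    ((#|A|%:R <= delta * n%:R) && (q * #|A| < edges_in lk Ls A)%N) ||
    ((#|A| <= n)%N && (9 * p * #|A| < edges_in lk Ls A)%N)].

Hypothesis n_gt1 : (1 < n)%N.
Hypothesis q5 : (5 <= q)%N.
Hypothesis pq : (q <= 9 * p)%N.
Hypothesis delta_gt0 : 0 < delta.
Hypothesis delta_half : delta <= 2^-1.
Hypothesis delta_d : 8 * 2 ^+ d * delta ^+ (q - 5) <= 1.
Hypothesis delta_p : 4 <= p%:R * delta.

Definition small_term (s : nat) : R := (2 ^+ d * (s%:R / n%:R) ^+ q) ^+ s.

(** With x = s/n the binomial is at most (8/x)^s. Of the q powers of x one cancels 1/x, q - 5 absorb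
    8 * 2^d by [delta_d], and four remain, giving x^(4s) <= n^-4. *)
Lemma bin_small_term s : (0 < s)%N -> s%:R <= delta * n%:R ->
  'C(n + n, s)%:R * small_term s <= n%:R^-1 ^+ 4.
Proof.
move=> s0 sd; have nR : 0 < n%:R :> R by rewrite ltr0n ltnW.
have sR : 0 < s%:R :> R by rewrite ltr0n.
set x := s%:R / n%:R : R.
have x0 : 0 < x by rewrite divr_gt0.
have xd : x <= delta by rewrite ler_pdivrMr.
have sn2 : (2 * s <= n)%N.
  by rewrite -(ler_nat R) natrM mulrC -ler_pdivlMr // (le_trans sd) // [leRHS]mulrC ler_wpM2r.
apply: (@le_trans _ _ ((x ^+ 4) ^+ s)); last first.
  rewrite exprAC; apply: lerXn2r; rewrite ?nnegrE ?exprn_ge0 ?invr_ge0 ?(ltW x0) //.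
  exact: expr_ratio_le.
apply: (@le_trans _ _ ((8 / x) ^+ s * small_term s)).
  rewrite ler_wpM2r ?exprn_ge0 ?mulr_ge0 ?exprn_ge0 ?(ltW x0) //.
  apply: le_trans (bin_le_expn R _ s0) _.
  rewrite le_eqVlt; apply/orP; left; apply/eqP; congr (_ ^+ _).
  by rewrite /x natrD; field; rewrite !gt_eqF.
rewrite /small_term -/x -exprMn; apply: lerXn2r; rewrite ?nnegrE ?mulr_ge0 ?exprn_ge0 ?invr_ge0 ?(ltW x0) //.
have -> : q = (4 + (q - 5)).+1 by rewrite -addSn subnKC.
rewrite exprS exprD.
have -> : 8 / x * (2 ^+ d * (x * (x ^+ 4 * x ^+ (q - 5)))) = x ^+ 4 * (8 * 2 ^+ d * x ^+ (q - 5)).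
  by field; rewrite gt_eqF.
rewrite ler_piMr ?exprn_ge0 ?(ltW x0) //; apply: le_trans delta_d.
rewrite ler_wpM2l ?mulr_ge0 ?exprn_ge0 //; apply: lerXn2r; rewrite ?nnegrE ?(ltW x0) ?(ltW delta_gt0) //.
Qed.

(** Small sets are grouped by size, and each of at most n + 1 sizes costs n^-4. For the others, all
    4^n sets are allowed: a set of more than delta n vertices fails with probability at most 2^(-p
    delta n) <= 16^-n by [delta_p]. *)
Lemma card_link_bad :
  #|[set Ls | link_bad Ls]|%:R <= #|latin n|%:R ^+ d * (2 / n%:R ^+ 2) :> R.
Proof.
have nR : 0 < n%:R :> R by rewrite ltr0n ltnW.
pose small (A : {set 'I_n + 'I_n}) := (#|A|%:R <= delta * n%:R) && (0 < #|A|)%N.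
pose large (A : {set 'I_n + 'I_n}) := (delta * n%:R < #|A|%:R) && (#|A| <= n)%N.
pose S1 (A : {set 'I_n + 'I_n}) := [set Ls : {ffun 'I_d -> latin n} | (q * #|A| <= edges_in lk Ls A)%N].
pose S2 (A : {set 'I_n + 'I_n}) := [set Ls : {ffun 'I_d -> latin n} | (9 * p * #|A| < edges_in lk Ls A)%N].
have cover : (#|[set Ls | link_bad Ls]| <= \sum_(A | small A) #|S1 A| + \sum_(A | large A) #|S2 A|)%N.
  have sumE P (S : {set 'I_n + 'I_n} -> {set {ffun 'I_d -> latin n}}) :
      (\sum_(A | P A) #|S A| = \sum_(Ls : {ffun 'I_d -> latin n}) \sum_(A | P A) (Ls \in S A))%N.
    rewrite exchange_big /=; apply: eq_bigr => A _.
    by rewrite -sum1_card big_mkcond /=; apply: eq_bigr => Ls _; case: (_ \in _).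
  rewrite !sumE -big_split -sum1_card big_mkcond /=; apply: leq_sum => Ls _.
  rewrite inE; case: ifP => // /existsP[A bad].
  have A0 : (0 < #|A|)%N.
    have /leq_trans := edges_in_le_left lk Ls A; rewrite card_parts => H.
    rewrite lt0n; apply: contraTneq bad => /eqP; rewrite addn_eq0 => /andP[/eqP u0 _].
    have : (edges_in lk Ls A <= 0)%N by apply: H; rewrite u0 muln0.
    by rewrite leqn0 => /eqP ->; rewrite !ltn0 !andbF.
  (* A set of at most delta n vertices that violates only the second bound still has [Ls] in [S1 A],
     as q <= 9p. *)
  have [Ad|dA] := leP (#|A|%:R) (delta * n%:R).
    apply: leq_trans (leq_addr _ _).
    rewrite (bigD1 A) /=; last by rewrite /small Ad.
    rewrite (_ : Ls \in S1 A) // inE; case/orP: bad => /andP[_ /ltnW //].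
    by apply: leq_trans; rewrite leq_mul2r pq orbT.
  move: bad; rewrite leNgt dA /= => /andP[An e].
  apply: leq_trans (leq_addl _ _).
  rewrite (bigD1 A) /=; last by rewrite /large dA.
  by rewrite (_ : Ls \in S2 A) // inE.
have small_n s : s%:R <= delta * n%:R -> (s <= n)%N.
  by move=> H; rewrite -(ler_nat R) (le_trans H) // ler_piMl // (le_trans delta_half) // invf_le1 // ler1n.
have n2 : 0 < n%:R^-1 :> R by rewrite invr_gt0.
have H1 : \sum_(A | small A) #|S1 A|%:R <= #|latin n|%:R ^+ d * n%:R^-1 ^+ 2 :> R.
  apply: (@le_trans _ _ (\sum_(A | small A) #|latin n|%:R ^+ d * small_term #|A|)).
    apply: ler_sum => A /andP[Ad A0]; apply: small_edges_tail => //.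
    by rewrite A0 small_n.
  rewrite -mulr_sumr ler_wpM2l ?exprn_ge0 //.
  rewrite (partition_big (fun A : {set 'I_n + 'I_n} => inord #|A| : 'I_n.+1) xpredT) //=.
  apply: (@le_trans _ _ (\sum_(s < n.+1) n%:R^-1 ^+ 4)).
    apply: ler_sum => s _.
    have AE A : small A -> (inord #|A| == s) = (#|A| == s).
      by move=> /andP[/small_n An _]; rewrite -val_eqE /= inordK.
    have [sd|sd] := boolP ((s%:R <= delta * n%:R) && (0 < s)%N).
      have /andP[sd1 s0] := sd; apply: le_trans (bin_small_term s0 sd1).
      have -> : 'C(n + n, s) = #|[set A : {set 'I_n + 'I_n} | #|A| == s]|.
        by rewrite card_draws card_sum !card_ord.
      rewrite mulr_natl -sumr_const big_mkcond [leRHS]big_mkcond /=; apply: ler_sum => A _.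
      rewrite inE; case: (boolP (small A)) => [sA|_] /=; last first.
        by case: ifP => // _; rewrite exprn_ge0 // mulr_ge0 // exprn_ge0 // divr_ge0.
      by rewrite AE //; case: eqP => // ->.
    rewrite big1 ?exprn_ge0 ?(ltW n2) // => A /andP[sA]; rewrite AE // => /eqP As.
    by move: sA; rewrite /small As (negbTE sd).
  rewrite sumr_const card_ord -(mulr_natl _ n.+1) -[4%N]/(2 + 2)%N exprD.
  rewrite mulrA ler_piMl ?exprn_ge0 ?(ltW n2) //.
  rewrite exprVn ler_pdivrMr ?exprn_gt0 // mul1r -natrX ler_nat; move: n_gt1; nia.
have H2 : \sum_(A | large A) #|S2 A|%:R <= #|latin n|%:R ^+ d * n%:R^-1 ^+ 2 :> R.
  apply: (@le_trans _ _ (\sum_(A : {set 'I_n + 'I_n}) #|latin n|%:R ^+ d * 16^-1 ^+ n)).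
    rewrite big_mkcond; apply: ler_sum => A _; case: ifP => [/andP[dA An]|_]; last first.
      by rewrite mulr_ge0 ?exprn_ge0 ?invr_ge0.
    have A0 : (0 < #|A|)%N.
      by rewrite -(ltr_nat R) (le_lt_trans _ dA) // mulr_ge0 // ltW.
    apply: le_trans (large_edges_tail _) _; first by rewrite A0.
    rewrite ler_wpM2l ?exprn_ge0 // exprVn lef_pV2 ?posrE ?exprn_gt0 //.
    rewrite (_ : 16 = 2 ^+ 4 :> R) -?exprM; last by ring.
    apply: ler_weXn2l; first by rewrite ler1n.
    rewrite -(ler_nat R) !natrM; apply: (@le_trans _ _ (p%:R * (delta * n%:R))).
      by rewrite mulrA ler_wpM2r.
    by rewrite ler_wpM2l // ltW.
  rewrite sumr_const -[leLHS]mulr_natl mulrCA ler_wpM2l ?exprn_ge0 //.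
  have -> : #|{set 'I_n + 'I_n}| = (4 ^ n)%N.
    by rewrite -cardsT -powersetT card_powerset cardsT card_sum !card_ord addnn -mul2n expnM.
  rewrite natrX exprVn -expr_div_n (_ : 4 / 16 = (2 ^+ 2)^-1 :> R); last by field.
  rewrite !exprVn -!exprM lef_pV2 ?posrE ?exprn_gt0 // mulnC exprM.
  apply: lerXn2r; rewrite ?nnegrE ?exprn_ge0 //.
  by rewrite -natrX ler_nat ltnW // ltn_expl.
move: cover; rewrite -(ler_nat R) natrD !natr_sum => /le_trans; apply.
apply: le_trans (lerD H1 H2) _.
by rewrite -mulrDr exprVn mulr2n mulrDl mul1r.
Qed.

End LinkUnion.

(** * Cochains on the complete tripartite complex *)

Section TripartiteCochains.
Variable n : nat.

(* The support of a 1-cochain, split into its values on the edges [a_i b_j],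
   [b_j c_k] and [a_i c_k]. *)
Definition cochain3 : finType :=
  ({ffun 'I_n * 'I_n -> bool} * {ffun 'I_n * 'I_n -> bool} * {ffun 'I_n * 'I_n -> bool})%type.

Definition ab (f : cochain3) : {ffun 'I_n * 'I_n -> bool} := f.1.1.
Definition bc (f : cochain3) : {ffun 'I_n * 'I_n -> bool} := f.1.2.
Definition ac (f : cochain3) : {ffun 'I_n * 'I_n -> bool} := f.2.

Definition weight (f : cochain3) : nat :=
  \sum_i \sum_j ab f (i, j) + \sum_j \sum_k bc f (j, k) + \sum_i \sum_k ac f (i, k).

(** Addition of the coboundary of the 0-cochain with values [ga], [gb], [gc] on the three vertex
    classes. *)
Definition shift (ga gb gc : 'I_n -> bool) (f : cochain3) : cochain3 :=
  ([ffun e => ab f e (+) ga e.1 (+) gb e.2], [ffun e => bc f e (+) gb e.1 (+) gc e.2],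
   [ffun e => ac f e (+) ga e.1 (+) gc e.2]).

Definition minimal (f : cochain3) : Prop :=
  forall ga gb gc, (weight f <= weight (shift ga gb gc f))%N.

Definition cobd (f : cochain3) (i j k : 'I_n) : bool :=
  ab f (i, j) (+) bc f (j, k) (+) ac f (i, k).

Lemma sum_cst (F : nat) : (\sum_(i < n) F = n * F)%N.
Proof. by rewrite sum_nat_const card_ord. Qed.

(** A cone argument: for a base triple (i0, j0, k0) the cochain is normalised along a spanning tree,
    and each edge value becomes a sum of coboundary values on triangles with a base vertex, one for
    an edge b c, two for a c, four for a b. Averaged over the base triples, each of these 1 + 2 + 4
    sums is E/n. *)
Lemma minimal_weight_le f : minimal f ->
  (n * weight f <= 7 * \sum_i \sum_j \sum_k cobd f i j k)%N.
Proof.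
move=> fmin; set E := (\sum_i _)%N.
case: (posnP n) => [n0|n0]; first by rewrite n0.
have base i0 j0 k0 : (weight f <=
    \sum_j \sum_k cobd f i0 j k
    + (\sum_i \sum_k cobd f i j0 k + \sum_(i < n) \sum_k cobd f i0 j0 k)
    + (\sum_i \sum_j cobd f i j k0 + \sum_(i < n) \sum_j cobd f i0 j k0
       + \sum_i \sum_(j < n) cobd f i j0 k0 + \sum_(i < n) \sum_(j < n) cobd f i0 j0 k0))%N.
  (* This shift vanishes on the edges [a_i0 b_j], [a_i0 c_k] and [a_i b_j0]. *)
  apply: leq_trans (fmin (fun i => ab f (i, j0) (+) ab f (i0, j0)) (fun j => ab f (i0, j))
    (fun k => ac f (i0, k))) _.
  set g := shift _ _ _ f.
  have hab : (\sum_i \sum_j ab g (i, j) <= \sum_i \sum_j cobd f i j k0 + \sum_(i < n) \sum_j cobd f i0 j k0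
       + \sum_i \sum_(j < n) cobd f i j0 k0 + \sum_(i < n) \sum_(j < n) cobd f i0 j0 k0)%N.
    rewrite -!big_split; apply: leq_sum => i _; rewrite -!big_split; apply: leq_sum => j _.
    rewrite /= ffunE /= /cobd.
    by move: (ab f (i, j)) (ab f (i, j0)) (ab f (i0, j0)) (ab f (i0, j)) (bc f (j, k0))
       (ac f (i, k0)) (bc f (j0, k0)) (ac f (i0, k0)) => [] [] [] [] [] [] [] [].
  have hbc : (\sum_j \sum_k bc g (j, k) <= \sum_j \sum_k cobd f i0 j k)%N.
    apply: leq_sum => j _; apply: leq_sum => k _; rewrite /= ffunE /= /cobd.
    by move: (ab f (i0, j)) (bc f (j, k)) (ac f (i0, k)) => [] [] [].
  have hac : (\sum_i \sum_k ac g (i, k) <=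
      \sum_i \sum_k cobd f i j0 k + \sum_(i < n) \sum_k cobd f i0 j0 k)%N.
    rewrite -big_split; apply: leq_sum => i _; rewrite -big_split; apply: leq_sum => k _.
    rewrite /= ffunE /= /cobd.
    by move: (ab f (i, j0)) (ab f (i0, j0)) (ac f (i, k)) (bc f (j0, k)) (ac f (i0, k)) => [] [] [] [] [].
  apply: leq_trans (leq_add (leq_add hab hbc) hac) _.
  by rewrite -addnA addnC.
pose d i j k : nat := cobd f i j k.
have t1 : (\sum_(i0 < n) \sum_(j0 < n) \sum_(k0 < n) \sum_j \sum_k d i0 j k = n * n * E)%N.
  by under eq_bigr do rewrite !sum_cst; rewrite -!big_distrr /= mulnA.
have t2 : (\sum_(i0 < n) \sum_(j0 < n) \sum_(k0 < n) \sum_i \sum_k d i j0 k = n * n * E)%N.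
  under eq_bigr do under eq_bigr do rewrite sum_cst.
  by rewrite sum_cst -big_distrr /= mulnA exchange_big.
have t3 : (\sum_(i0 < n) \sum_(j0 < n) \sum_(k0 < n) \sum_(i < n) \sum_k d i0 j0 k = n * n * E)%N.
  under eq_bigr do under eq_bigr do rewrite !sum_cst.
  by under eq_bigr do rewrite -!big_distrr /=; rewrite -!big_distrr /= mulnA.
have t4 : (\sum_(i0 < n) \sum_(j0 < n) \sum_(k0 < n) \sum_i \sum_j d i j k0 = n * n * E)%N.
  rewrite !sum_cst mulnA exchange_big /=; congr (_ * _)%N; apply: eq_bigr => i _.
  by rewrite exchange_big.
have t5 : (\sum_(i0 < n) \sum_(j0 < n) \sum_(k0 < n) \sum_(i < n) \sum_j d i0 j k0 = n * n * E)%N.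
  under eq_bigr do rewrite sum_cst; rewrite -big_distrr /=.
  under eq_bigr do under eq_bigr do rewrite sum_cst.
  under eq_bigr do rewrite -big_distrr /= exchange_big.
  by rewrite -big_distrr /= mulnA.
have t6 : (\sum_(i0 < n) \sum_(j0 < n) \sum_(k0 < n) \sum_i \sum_(j < n) d i j0 k0 = n * n * E)%N.
  rewrite sum_cst -mulnA; congr (_ * _)%N.
  under eq_bigr do under eq_bigr do under eq_bigr do rewrite sum_cst.
  under eq_bigr do under eq_bigr do rewrite -big_distrr /=.
  under eq_bigr do rewrite -big_distrr /= exchange_big.
  by rewrite -big_distrr /= exchange_big.
have t7 : (\sum_(i0 < n) \sum_(j0 < n) \sum_(k0 < n) \sum_(i < n) \sum_(j < n) d i0 j0 k0 = n * n * E)%N.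
  under eq_bigr do under eq_bigr do under eq_bigr do rewrite !sum_cst.
  under eq_bigr do under eq_bigr do rewrite -!big_distrr /=.
  by under eq_bigr do rewrite -!big_distrr /=; rewrite -!big_distrr /= mulnA.
have H : (\sum_(i0 < n) \sum_(j0 < n) \sum_(k0 < n) weight f <= n * n * (7 * E))%N.
  apply: (@leq_trans (\sum_(i0 < n) \sum_(j0 < n) \sum_(k0 < n) (
    \sum_j \sum_k d i0 j k
    + (\sum_i \sum_k d i j0 k + \sum_(i < n) \sum_k d i0 j0 k)
    + (\sum_i \sum_j d i j k0 + \sum_(i < n) \sum_j d i0 j k0
       + \sum_i \sum_(j < n) d i j0 k0 + \sum_(i < n) \sum_(j < n) d i0 j0 k0)))).
    by apply: leq_sum => i _; apply: leq_sum => j _; apply: leq_sum => k _; apply: base.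
  have split3 (F G : 'I_n -> 'I_n -> 'I_n -> nat) :
      (\sum_(i0 < n) \sum_(j0 < n) \sum_(k0 < n) (F i0 j0 k0 + G i0 j0 k0) =
       \sum_i0 \sum_j0 \sum_k0 F i0 j0 k0 + \sum_i0 \sum_j0 \sum_k0 G i0 j0 k0)%N.
    rewrite -big_split; apply: eq_bigr => i _; rewrite -big_split; apply: eq_bigr => j _.
    by rewrite -big_split.
  rewrite !split3 t1 t2 t3 t4 t5 t6 t7; lia.
rewrite !sum_cst in H.
by rewrite -(leq_pmul2l n0) -(leq_pmul2l n0); move: H; rewrite -!mulnA.
Qed.
End TripartiteCochains.

(** * Cochains of small weight, through their links *)

Section SmallCochains.
Variables (n : nat) (f : cochain3 n).

(** The edges of f at one vertex, recorded by their other ends. In all three cases [inl] holds the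
    source side and [inr] the target side of the permutation that is the link of this vertex in
    Y(L). *)
Definition link_a (i : 'I_n) : {set 'I_n + 'I_n} :=
  [set v | match v with inl j => ab f (i, j) | inr k => ac f (i, k) end].
Definition link_b (j : 'I_n) : {set 'I_n + 'I_n} :=
  [set v | match v with inl i => ab f (i, j) | inr k => bc f (j, k) end].
Definition link_c (k : 'I_n) : {set 'I_n + 'I_n} :=
  [set v | match v with inl i => ac f (i, k) | inr j => bc f (j, k) end].

Lemma card_sumset (A : {set 'I_n + 'I_n}) :
  #|A| = (\sum_i (inl i \in A) + \sum_i (inr i \in A))%N.
Proof.
rewrite -sum1_card big_mkcond /= big_sumType /=; congr (_ + _)%N;
by apply: eq_bigr => i _; case: (_ \in A).
Qed.

Lemma card_link_a i : #|link_a i| = (\sum_j ab f (i, j) + \sum_k ac f (i, k))%N.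
Proof. by rewrite card_sumset; congr (_ + _)%N; apply: eq_bigr => x _; rewrite inE. Qed.
Lemma card_link_b j : #|link_b j| = (\sum_i ab f (i, j) + \sum_k bc f (j, k))%N.
Proof. by rewrite card_sumset; congr (_ + _)%N; apply: eq_bigr => x _; rewrite inE. Qed.
Lemma card_link_c k : #|link_c k| = (\sum_i ac f (i, k) + \sum_j bc f (j, k))%N.
Proof. by rewrite card_sumset; congr (_ + _)%N; apply: eq_bigr => x _; rewrite inE. Qed.

Lemma sum_card_link :
  (\sum_i #|link_a i| + \sum_j #|link_b j| + \sum_k #|link_c k| = 2 * weight f)%N.
Proof.
under eq_bigr do rewrite card_link_a.
under [X in (_ + X + _)%N]eq_bigr do rewrite card_link_b.
under [X in (_ + X)%N]eq_bigr do rewrite card_link_c.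
rewrite !big_split /= (exchange_big _ _ _ _ _ (fun j i => nat_of_bool (ab f (i, j)))) /=.
rewrite (exchange_big _ _ _ _ _ (fun k i => nat_of_bool (ac f (i, k)))) /=.
rewrite (exchange_big _ _ _ _ _ (fun k i => nat_of_bool (bc f (i, k)))) /=.
have lin (a b c : nat) : (a + c + (a + b) + (c + b) = 2 * (a + b + c))%N by lia.
exact: lin.
Qed.

(** An edge of f is counted once for each of its ends in H. The edges counted twice join two
    vertices of H, and there are at most as many as the squared size of H. *)
Lemma sum_high_link (Ha Hb Hc : 'I_n -> bool) :
  (\sum_i Ha i * #|link_a i| + \sum_j Hb j * #|link_b j| + \sum_k Hc k * #|link_c k| <=
   weight f + (\sum_i Ha i + \sum_j Hb j + \sum_k Hc k) ^ 2)%N.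
Proof.
have pair (P Q : 'I_n -> bool) (x : 'I_n * 'I_n -> bool) :
   (\sum_i P i * (\sum_j x (i, j)) + \sum_j Q j * (\sum_i x (i, j)) <=
    \sum_i \sum_j x (i, j) + (\sum_i P i) * (\sum_j Q j))%N.
  rewrite big_distrl /=.
  under eq_bigr do rewrite big_distrr /=.
  under [X in (_ + X <= _)%N]eq_bigr do rewrite big_distrr /=.
  rewrite [X in (_ + X <= _)%N]exchange_big /= -!big_split /=; apply: leq_sum => i _.
  rewrite big_distrr /= -!big_split /=; apply: leq_sum => j _.
  by case: (P i) (Q j) (x (i, j)) => [] [] [].
have Hab := pair Ha Hb (ab f); have Hbc := pair Hb Hc (bc f); have Hac := pair Ha Hc (ac f).
under eq_bigr do rewrite card_link_a mulnDr.
under [X in (_ + X + _ <= _)%N]eq_bigr do rewrite card_link_b mulnDr.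
under [X in (_ + X <= _)%N]eq_bigr do rewrite card_link_c mulnDr.
rewrite !big_split /= /weight.
have lin (a1 a2 b1 b2 c1 c2 s1 s2 s3 p q r : nat) :
    (a1 + b1 <= s1 + p * q -> b2 + c1 <= s2 + q * r -> a2 + c2 <= s3 + p * r ->
     a1 + a2 + (b1 + b2) + (c2 + c1) <= s1 + s2 + s3 + (p + q + r) ^ 2)%N by nia.
exact: lin Hab Hbc Hac.
Qed.

Lemma flip_row (x : 'I_n -> 'I_n -> bool) i0 :
  (\sum_i \sum_j (x i j (+) (i == i0)) + 2 * \sum_j x i0 j = \sum_i \sum_j x i j + n)%N.
Proof.
rewrite (bigD1 i0) //= [in RHS](bigD1 i0) //= eqxx.
have -> : (\sum_(i | i != i0) \sum_j (x i j (+) (i == i0)) = \sum_(i | i != i0) \sum_j x i j)%N.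
  by apply: eq_bigr => i /negbTE ->; apply: eq_bigr => j _; rewrite addbF.
have row : (\sum_j (x i0 j (+) true) + \sum_j x i0 j = n)%N.
  rewrite -big_split /= (eq_bigr (fun=> 1%N)) => [|j _]; last by case: (x i0 j).
  by rewrite sum1_card card_ord.
have lin (a t u m : nat) : (a + u = m -> a + t + 2 * u = u + t + m)%N by lia.
exact: lin row.
Qed.

Lemma flip_col (x : 'I_n -> 'I_n -> bool) j0 :
  (\sum_i \sum_j (x i j (+) (j == j0)) + 2 * \sum_i x i j0 = \sum_i \sum_j x i j + n)%N.
Proof. by rewrite exchange_big /= (flip_row (fun j i => x i j)) exchange_big. Qed.

(** Adding the coboundary of one vertex exchanges f with its complement on the 2n edges at that
    vertex, so minimality allows at most n of them. *)
Lemma minimal_link_a i0 : minimal f -> (#|link_a i0| <= n)%N.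
Proof.
move/(_ (fun i => i == i0) (fun=> false) (fun=> false)); rewrite /weight card_link_a.
under [X in (_ <= X + _ + _)%N]eq_bigr do under eq_bigr do rewrite ffunE addbF.
under [X in (_ <= _ + X + _)%N]eq_bigr do under eq_bigr do rewrite ffunE !addbF.
under [X in (_ <= _ + X)%N]eq_bigr do under eq_bigr do rewrite ffunE addbF.
have lin (a b c a' c' u v : nat) : (a' + 2 * u = a + n -> c' + 2 * v = c + n ->
  a + b + c <= a' + b + c' -> u + v <= n)%N by lia.
exact: lin (flip_row (fun i j => ab f (i, j)) i0) (flip_row (fun i j => ac f (i, j)) i0).
Qed.

Lemma minimal_link_b j0 : minimal f -> (#|link_b j0| <= n)%N.
Proof.
move/(_ (fun=> false) (fun j => j == j0) (fun=> false)); rewrite /weight card_link_b.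
under [X in (_ <= X + _ + _)%N]eq_bigr do under eq_bigr do rewrite ffunE addbF.
under [X in (_ <= _ + X + _)%N]eq_bigr do under eq_bigr do rewrite ffunE addbF.
under [X in (_ <= _ + X)%N]eq_bigr do under eq_bigr do rewrite ffunE !addbF.
have lin (a b c a' b' u v : nat) : (a' + 2 * u = a + n -> b' + 2 * v = b + n ->
  a + b + c <= a' + b' + c -> u + v <= n)%N by lia.
exact: lin (flip_col (fun i j => ab f (i, j)) j0) (flip_row (fun j k => bc f (j, k)) j0).
Qed.

Lemma minimal_link_c k0 : minimal f -> (#|link_c k0| <= n)%N.
Proof.
move/(_ (fun=> false) (fun=> false) (fun k => k == k0)); rewrite /weight card_link_c.
under [X in (_ <= X + _ + _)%N]eq_bigr do under eq_bigr do rewrite ffunE !addbF.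
under [X in (_ <= _ + X + _)%N]eq_bigr do under eq_bigr do rewrite ffunE addbF.
under [X in (_ <= _ + X)%N]eq_bigr do under eq_bigr do rewrite ffunE addbF.
have lin (a b c b' c' u v : nat) : (c' + 2 * u = c + n -> b' + 2 * v = b + n ->
  a + b + c <= a + b' + c' -> u + v <= n)%N by lia.
exact: lin (flip_col (fun i j => ac f (i, j)) k0) (flip_col (fun j k => bc f (j, k)) k0).
Qed.

Variables (d : nat) (Ls : {ffun 'I_d -> latin n}).

Definition triangles (k : 'I_d) : nat :=
  \sum_i \sum_j cobd f i j (val (Ls k) i j).

(** Every edge lies in exactly one triangle of each Y(L_k), so the left side counts the edges of f
    triangle by triangle. Two edges of f in a triangle meet at a vertex, and there they form an edge
    of the link inside the set of f. *)
Lemma weight_le_triangles :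
  (d * weight f <= \sum_k triangles k +
   2 * (\sum_i edges_in (fun L : latin n => val L i) Ls (link_a i) +
        \sum_j edges_in (fun L => col_perm L j) Ls (link_b j) +
        \sum_l edges_in (fun L => symbol_perm L l) Ls (link_c l)))%N.
Proof.
have bcE (L : latin n) : (\sum_i \sum_j bc f (j, val L i j) = \sum_j \sum_k bc f (j, k))%N.
  rewrite exchange_big /=; apply: eq_bigr => j _.
  by rewrite [RHS](reindex_perm (col_perm L j)) /=; apply: eq_bigr => i _; rewrite permE.
have acE (L : latin n) : (\sum_i \sum_j ac f (i, val L i j) = \sum_i \sum_k ac f (i, k))%N.
  by apply: eq_bigr => i _; rewrite [RHS](reindex_perm (val L i)).
have weightE : (d * weight f = \sum_k \sum_i \sum_j
    (ab f (i, j) + bc f (j, val (Ls k) i j) + ac f (i, val (Ls k) i j)))%N.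
  rewrite -[X in (X * _)%N]card_ord -sum_nat_const; apply: eq_bigr => k _.
  rewrite /weight -(bcE (Ls k)) -(acE (Ls k)) -!big_split; apply: eq_bigr => i _.
  by rewrite -!big_split.
have cardI (U W : {set 'I_n}) (s : 'S_n) :
    (#|[set x in U | s x \in W]| = \sum_x ((x \in U) && (s x \in W)))%N.
  by rewrite -sum1_card big_mkcond /=; apply: eq_bigr => x _; rewrite inE; case: (_ && _).
have eaE : (\sum_i edges_in (fun L : latin n => val L i) Ls (link_a i) =
    \sum_k \sum_i \sum_j (ab f (i, j) && ac f (i, val (Ls k) i j)))%N.
  rewrite exchange_big /=; apply: eq_bigr => i _; apply: eq_bigr => k _.
  by rewrite cardI; apply: eq_bigr => j _; rewrite !inE.
have ebE : (\sum_j edges_in (fun L => col_perm L j) Ls (link_b j) =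
    \sum_k \sum_i \sum_j (ab f (i, j) && bc f (j, val (Ls k) i j)))%N.
  rewrite /edges_in /link_edges exchange_big /=; apply: eq_bigr => k _.
  rewrite [RHS]exchange_big; apply: eq_bigr => j _.
  by rewrite cardI; apply: eq_bigr => i _; rewrite !inE permE.
have ecE : (\sum_l edges_in (fun L => symbol_perm L l) Ls (link_c l) =
    \sum_k \sum_i \sum_j (ac f (i, val (Ls k) i j) && bc f (j, val (Ls k) i j)))%N.
  rewrite /edges_in /link_edges exchange_big /=; apply: eq_bigr => k _.
  rewrite (eq_bigr (fun l => \sum_i (ac f (i, l) && bc f (((val (Ls k) i)^-1)%g l, l))))%N
    => [|l _]; last first.
    by rewrite cardI; apply: eq_bigr => i _; rewrite !inE permE.
  rewrite exchange_big /=; apply: eq_bigr => i _.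
  rewrite (reindex_perm (val (Ls k) i)) /=; apply: eq_bigr => j _.
  by rewrite permK.
rewrite weightE eaE ebE ecE /triangles -!big_split big_distrr -big_split /=; apply: leq_sum => k _.
rewrite -!big_split big_distrr -big_split /=; apply: leq_sum => i _.
rewrite -!big_split big_distrr -big_split /=; apply: leq_sum => j _.
(* [a + b + c <= (a (+) b (+) c) + 2 * (a * c + a * b + c * b)] for bits. *)
rewrite /cobd.
by case: (ab f _) (bc f _) (ac f _) => [] [] [].
Qed.
End SmallCochains.

(** Let w be the weight and h the number of vertices whose degree in f exceeds delta n. Then h <=
    2w/(delta n), so h^2 <= w/100 by the factor 400. The links contain at most 2qw + 9p (w + h^2)
    edges inside the sets of f; twice this is at most 18.58 p w, since q = p/10, and 20 p w exceeds
    it by more than p w. *)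
Lemma small_cochain_expansion (R : realType) (n d p q : nat) (delta : R)
    (f : cochain3 n) (Ls : {ffun 'I_d -> latin n}) :
  (0 < n)%N -> d = (20 * p)%N -> p = (10 * q)%N -> 0 < delta ->
  minimal f -> 400 * (weight f)%:R <= (delta * n%:R) ^+ 2 ->
  (forall i, ~~ link_bad p q delta (fun L : latin n => val L i) Ls) ->
  (forall j, ~~ link_bad p q delta (fun L => col_perm L j) Ls) ->
  (forall l, ~~ link_bad p q delta (fun L => symbol_perm L l) Ls) ->
  (p * weight f <= \sum_k triangles f Ls k)%N.
Proof.
move=> n0 dE pE delta0 fmin wsmall gooda goodb goodc.
pose high (A : {set 'I_n + 'I_n}) : bool := delta * n%:R < #|A|%:R.
have edges lk (A : {set 'I_n + 'I_n}) : ~~ link_bad p q delta lk Ls -> (#|A| <= n)%N ->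
    (edges_in lk Ls A <= q * #|A| + 9 * p * (high A * #|A|))%N.
  rewrite negb_exists => /forallP/(_ A); rewrite negb_or => /andP[lo hi] An.
  rewrite /high; have [Ad|dA] := leP (#|A|%:R) (delta * n%:R).
    by move: lo; rewrite Ad /= -leqNgt => /leq_trans; apply; apply: leq_addr.
  move: hi; rewrite An /= -leqNgt mul1n => /leq_trans; apply; exact: leq_addl.
have sumedges (lk : 'I_n -> latin n -> 'S_n) (A : 'I_n -> {set 'I_n + 'I_n}) :
    (forall i, ~~ link_bad p q delta (lk i) Ls) -> (forall i, #|A i| <= n)%N ->
    (\sum_i edges_in (lk i) Ls (A i) <=
     q * (\sum_i #|A i|) + 9 * p * (\sum_i high (A i) * #|A i|))%N.
  move=> good An; rewrite !big_distrr -big_split /=; apply: leq_sum => i _.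
  exact: edges.
have highs (A : 'I_n -> {set 'I_n + 'I_n}) :
    delta * n%:R * (\sum_i high (A i))%:R <= (\sum_i #|A i|)%:R.
  rewrite !natr_sum mulr_sumr; apply: ler_sum => i _; rewrite /high.
  by case: ltP => [/ltW|_]; rewrite ?mulr1 ?mulr0.
have Ea := sumedges _ _ gooda (fun i => minimal_link_a i fmin).
have Eb := sumedges _ _ goodb (fun j => minimal_link_b j fmin).
have Ec := sumedges _ _ goodc (fun k => minimal_link_c k fmin).
set h := (\sum_i high (link_a f i) + \sum_j high (link_b f j) + \sum_k high (link_c f k))%N.
have Hh : (100 * h ^ 2 <= weight f)%N.
  have dn0 : 0 < delta * n%:R by rewrite mulr_gt0 ?ltr0n.
  have : delta * n%:R * h%:R <= 2 * (weight f)%:R.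
    rewrite -natrM -sum_card_link !natrD !mulrDr.
    by rewrite lerD ?lerD ?highs.
  move=> hw; have hw2 : (delta * n%:R * h%:R) ^+ 2 <= (2 * (weight f)%:R) ^+ 2.
    by apply: lerXn2r hw; rewrite nnegrE ?mulr_ge0 // ltW.
  rewrite -(ler_nat R) natrM natrX -(ler_pM2l (exprn_gt0 2 dn0)).
  apply: (@le_trans _ _ (400 * (weight f)%:R * (weight f)%:R)); last by rewrite ler_wpM2r.
  by move: hw2; rewrite !exprMn; clear; move: (delta ^+ 2 * _) (h%:R ^+ 2) (weight f)%:R => x y w; lra.
have lin (w t ea eb ec sa sb sc xa xb xc : nat) :
   (ea <= q * sa + 9 * p * xa -> eb <= q * sb + 9 * p * xb -> ec <= q * sc + 9 * p * xc ->
    d * w <= t + 2 * (ea + eb + ec) -> sa + sb + sc = 2 * w -> xa + xb + xc <= w + h ^ 2 ->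
    100 * h ^ 2 <= w -> p * w <= t)%N.
  move=> ha hb hc ht hs hx hh; rewrite pE; move: ht; rewrite dE pE => ht.
  have h1 : (q * sa + q * sb + q * sc = q * 2 * w)%N by rewrite -!mulnDr hs mulnA.
  have h2 : (9 * p * xa + 9 * p * xb + 9 * p * xc <= 9 * p * (w + h ^ 2))%N.
    by rewrite -!mulnDr leq_mul2l hx orbT.
  have h3 : (q * (100 * h ^ 2) <= q * w)%N by rewrite leq_mul2l hh orbT.
  move: h2; rewrite pE => h2; move: ha hb hc; rewrite pE.
  move: (h ^ 2)%N h2 h3 {hx hh} => u h2 h3; clear -h1 h2 h3 ht; nia.
exact: lin Ea Eb Ec (weight_le_triangles f Ls) (sum_card_link f) (sum_high_link f
  (fun i => high (link_a f i)) (fun j => high (link_b f j)) (fun k => high (link_c f k))) Hh.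
Qed.

(** * Random Latin squares expand *)

Section Probability.
Variable R : realType.

(** One square has to supply all the triangles: triangles of different squares may coincide in the
    union, and those of a single square are distinct. *)
Definition expanding (eps : R) (n d : nat) (Ls : {ffun 'I_d -> latin n}) : Prop :=
  forall f : cochain3 n, minimal f -> (0 < weight f)%N ->
  exists k, eps * (weight f)%:R < (triangles f Ls k)%:R.

Definition face_pred n (f : cochain3 n) (x : 'I_n * 'I_n) (v : 'I_n) : bool :=
  cobd f x.1 x.2 v.

Lemma trianglesE n d (f : cochain3 n) (Ls : {ffun 'I_d -> latin n}) k :
  triangles f Ls k = (\sum_x face_pred f x (entry (Ls k) x))%N.
Proof. by rewrite /triangles pair_big. Qed.

Lemma sum_face_pred n (f : cochain3 n) :
  (\sum_x \sum_v face_pred f x v = \sum_i \sum_j \sum_k cobd f i j k)%N.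
Proof. by rewrite [RHS]pair_big. Qed.

Lemma weight_le n (f : cochain3 n) : (weight f <= 3 * n ^ 2)%N.
Proof.
have le (x : 'I_n * 'I_n -> bool) : (\sum_i \sum_j x (i, j) <= n ^ 2)%N.
  apply: (@leq_trans (\sum_(i < n) \sum_(j < n) 1)).
    by apply: leq_sum => i _; apply: leq_sum => j _; apply: leq_b1.
  by rewrite !sum_cst muln1.
by have := leq_add (leq_add (le (ab f)) (le (bc f))) (le (ac f)); rewrite /weight; lia.
Qed.

(* The constant comes from [200 * q + 3 <= 401 * (q - 5)]. *)
Lemma delta_bound q : (10 <= q)%N ->
  8 * 2 ^+ (20 * (10 * q)) * (2^-1 ^+ 401) ^+ (q - 5) <= 1 :> R.
Proof.
move=> q10; rewrite -exprM exprVn ler_pdivrMr ?exprn_gt0 // mul1r.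
rewrite (_ : 8 = 2 ^+ 3 :> R) -?exprD; last by ring.
apply: ler_weXn2l; first by rewrite ler1n.
rewrite !mulnA mulnBr; apply: leq_trans (leq_sub2r _ (leq_mul (leqnn 401) (leqnn q))) => //.
lia.
Qed.

Lemma card_all_deviating (n d : nat) (S : {set latin n}) :
  #|[set Ls : {ffun 'I_d -> latin n} | [forall k, Ls k \in S]]| = (#|S| ^ d)%N.
Proof.
rewrite -[X in (_ ^ X)%N]card_ord -card_ffun_on; apply: eq_card => Ls.
by rewrite inE; apply/forallP/ffun_onP.
Qed.

Lemma expanding_whp : exists (eps : R) (d : nat) (N : nat), [/\ 0 < eps, (0 < d)%N &
  forall n, (N <= n)%N -> exists B : {set {ffun 'I_d -> latin n}},
    #|B|%:R <= #|latin n|%:R ^+ d * (7 / n%:R) :> R /\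
    forall Ls, Ls \notin B -> expanding eps Ls].
Proof.
pose delta : R := 2^-1 ^+ 401.
have delta0 : 0 < delta by rewrite exprn_gt0 // invr_gt0.
have delta12 : delta <= 2^-1.
  rewrite /delta exprS ler_piMr ?invr_ge0 // exprn_ile1 ?invr_ge0 // invf_le1 // ler1n //.
have delta_le := @delta_bound; rewrite -/delta in delta_le.
clearbody delta.
(* 2800 = 7 * 400: the loss in [minimal_weight_le] times the factor of the weight threshold (delta
   n)^2 / 400. *)
pose c := delta ^+ 2 / 2800.
have c0 : 0 < c by rewrite /c divr_gt0 ?exprn_gt0 ?ltr0n.
have [kappa [c' [N [kappa0 c'0 dev]]]] := latin_deviation c0.
(* 10 is for [delta_bound], 4/delta for large sets in the links, 4/[c'] for the union bound over
   cochains. *)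
pose q := (10 + Num.bound (4 / delta) + Num.bound (4 / c'))%N.
have q10 : (10 <= q)%N by rewrite /q -addnA leq_addr.
have large_q (x : R) : 0 < x -> (Num.bound (4 / x) <= q)%N -> 4 <= q%:R * x.
  move=> x0 xq; rewrite -ler_pdivrMr // ltW // (lt_le_trans (archi_boundP _)) ?ler_nat //.
  by rewrite divr_ge0 // ltW.
have qd : 4 <= q%:R * delta by apply: large_q; rewrite // /q -addnA addnCA leq_addr.
have qc : 4 <= q%:R * c' by apply: large_q; rewrite // /q leq_addl.
clearbody q; pose p := (10 * q)%N; pose d := (20 * p)%N.
(* Heavy cochains have more than kappa n^2 odd triangles in some square and weight at most 3 n^2.
   For light ones of weight w, the 20p squares have at least p w odd triangles in total, so one has
   at least w/20; 1/40 makes the inequality strict. *)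
exists (Num.min (kappa / 6) (1 / 40)), d, (maxn N 2); split.
- by rewrite lt_min !divr_gt0.
- by rewrite /d /p; lia.
move=> n; rewrite geq_max => /andP[Nn n2].
have nR : 0 < n%:R :> R by rewrite ltr0n ltnW.
pose large (f : cochain3 n) : bool := c * n%:R ^+ 3 <= (\sum_x \sum_v face_pred f x v)%:R.
pose S (f : cochain3 n) := [set L : latin n | (\sum_x face_pred f x (entry L x))%:R <= kappa * n%:R ^+ 2].
pose BL f := [set Ls : {ffun 'I_d -> latin n} | [forall k, Ls k \in S f]].
pose Ba i := [set Ls : {ffun 'I_d -> latin n} | link_bad p q delta (fun L : latin n => val L i) Ls].
pose Bb j := [set Ls : {ffun 'I_d -> latin n} | link_bad p q delta (fun L => col_perm L j) Ls].
pose Bc l := [set Ls : {ffun 'I_d -> latin n} | link_bad p q delta (fun L => symbol_perm L l) Ls].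
exists ((\bigcup_i Ba i) :|: (\bigcup_i Bb i) :|: (\bigcup_i Bc i) :|: (\bigcup_(f | large f) BL f)).
split; last first.
  move=> Ls; rewrite !inE !negb_or => /andP[/andP[/andP[a b] c1] l] f fmin f0.
  have notin (B : 'I_n -> {set {ffun 'I_d -> latin n}}) : Ls \notin \bigcup_i B i -> forall i, Ls \notin B i.
    by move=> H i; apply: contraNN H => H; apply/bigcupP; exists i.
  have [sm|lg] := leP (400 * (weight f)%:R) ((delta * n%:R) ^+ 2).
    have H : (p * weight f <= \sum_k triangles f Ls k)%N.
      apply: (small_cochain_expansion _ _ _ delta0 fmin sm) => // [|i|j|k]; first exact: ltnW.
      - by have := notin _ a i; rewrite inE.
      - by have := notin _ b j; rewrite inE.
      - by have := notin _ c1 k; rewrite inE.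
    have [/existsP[k Hk]|] := boolP [exists k, (weight f <= 20 * triangles f Ls k)%N].
      exists k; apply: (@le_lt_trans _ _ (1 / 40 * (weight f)%:R)).
        by rewrite ler_wpM2r // ge_min lexx orbT.
      have : (weight f)%:R <= (20 * triangles f Ls k)%:R :> R by rewrite ler_nat.
      have : 0 < (weight f)%:R :> R by rewrite ltr0n.
      by rewrite natrM; move: (weight f)%:R (triangles f Ls k)%:R => w t; clear; lra.
    rewrite negb_exists => /forallP H2; exfalso.
    have : (\sum_(k < d) (20 * triangles f Ls k).+1 <= \sum_(k < d) weight f)%N.
      by apply: leq_sum => k _; rewrite ltnNge.
    rewrite sum_nat_const card_ord; under eq_bigr do rewrite -addn1.
    rewrite big_split /= sum1_card card_ord -big_distrr /=.
    have p0 : (0 < p)%N by rewrite /p muln_gt0 /= (leq_trans _ q10).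
    move: H p0; rewrite /d; clearbody p; move: (\sum_k _)%N (weight f); clear => t w H p0 H2.
    have : (20 * p * w = 20 * (p * w))%N by rewrite mulnA.
    lia.
  have fl : large f.
    rewrite /large sum_face_pred; have := minimal_weight_le fmin.
    rewrite -(ler_nat R) !natrM.
    have : 7 * (c * n%:R ^+ 3) <= n%:R * (weight f)%:R.
      rewrite /c (exprS n%:R 2); move: lg; rewrite exprMn => /ltW; rewrite -(ler_pM2l nR).
      by move: (weight f)%:R n%:R (delta ^+ 2) (n%:R ^+ 2) => w z y x; clear; lra.
    by move=> /le_trans H /H; rewrite ler_pM2l ?ltr0n.
  have : Ls \notin BL f by apply: contraNN l => H; apply/bigcupP; exists f.
  rewrite inE negb_forall => /existsP[k]; rewrite inE -trianglesE -ltNge => Hk.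
  exists k; apply: le_lt_trans Hk; apply: (@le_trans _ _ (kappa / 6 * (weight f)%:R)).
    by rewrite ler_wpM2r // ge_min lexx.
  have : (weight f)%:R <= 3 * n%:R ^+ 2 :> R by rewrite -natrX -natrM ler_nat weight_le.
  have k6 : 0 <= kappa / 6 by rewrite divr_ge0 // ltW.
  move/(ler_wpM2l k6)/le_trans; apply.
  have : 0 <= kappa * n%:R ^+ 2 by rewrite mulr_ge0 ?exprn_ge0 // ltW.
  by clear; lra.
have lat0 : 0 <= #|latin n|%:R ^+ d :> R by rewrite exprn_ge0.
have link_bound lk : equivariant lk ->
    #|[set Ls : {ffun 'I_d -> latin n} | link_bad p q delta lk Ls]|%:R <=
    #|latin n|%:R ^+ d * (2 / n%:R ^+ 2) :> R.
  move=> eq_lk; apply: card_link_bad => //.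
  - by rewrite (leq_trans _ q10).
  - by rewrite /p; clear; lia.
  - exact: delta_le.
  - rewrite /p natrM (le_trans qd) // ler_wpM2r ?(ltW delta0) // ler_peMl // ler1n //.
have union_bound (B : 'I_n -> {set {ffun 'I_d -> latin n}}) :
    (forall i, #|B i|%:R <= #|latin n|%:R ^+ d * (2 / n%:R ^+ 2) :> R) ->
    #|\bigcup_i B i|%:R <= #|latin n|%:R ^+ d * (2 / n%:R) :> R.
  move=> HB; apply: (@le_trans _ _ (\sum_i #|B i|%:R)).
    rewrite -natr_sum ler_nat; elim/big_rec2: _ => [|i s C _ H]; first by rewrite cards0.
    by apply: leq_trans (leq_card_setU _ _) _; rewrite leq_add2l.
  apply: le_trans (ler_sum _ (fun i _ => HB i)) _.
  rewrite sumr_const card_ord -mulrnAr ler_wpM2l // -mulr_natr expr2 invfM mulrA mulfVK ?gt_eqF //.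
have Ua := union_bound Ba (fun i => link_bound _ (row_equivariant i)).
have Ub := union_bound Bb (fun j => link_bound _ (col_equivariant j)).
have Uc := union_bound Bc (fun l => link_bound _ (symbol_equivariant l)).
have Ul : #|\bigcup_(f | large f) BL f|%:R <= #|latin n|%:R ^+ d * (1 / n%:R) :> R.
  apply: (@le_trans _ _ (\sum_(f : cochain3 n | large f) #|BL f|%:R)).
    rewrite -natr_sum ler_nat; elim/big_rec2: _ => [|f s C _ H]; first by rewrite cards0.
    by apply: leq_trans (leq_card_setU _ _) _; rewrite leq_add2l.
  (* The exponent 4 n^2 beats the 2^(3 n^2) <= e^(3 n^2) cochains and leaves e^(-n^2) <= 1/n. *)
  apply: (@le_trans _ _ (\sum_(f : cochain3 n) #|latin n|%:R ^+ d * expR (- (4 * n%:R ^+ 2)))).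
    rewrite big_mkcond; apply: ler_sum => f _; case: ifP => [fl|_]; last first.
      by rewrite mulr_ge0 ?expR_ge0.
    rewrite card_all_deviating natrX.
    apply: (@le_trans _ _ ((#|latin n|%:R * expR (- c' * n%:R ^+ 2)) ^+ d)).
      apply: lerXn2r; rewrite ?nnegrE ?mulr_ge0 ?expR_ge0 //.
      exact: dev.
    rewrite exprMn ler_wpM2l // -expRM_natl ler_expR mulrA mulrN mulNr lerN2.
    rewrite ler_wpM2r ?exprn_ge0 // (le_trans qc) // ler_wpM2r ?(ltW c'0) // ler_nat /d /p.
    by clear; lia.
  rewrite sumr_const -mulrnAr ler_wpM2l //.
  have -> : #|cochain3 n| = (2 ^ (3 * n ^ 2))%N.
    rewrite !card_prod !card_ffun card_bool card_prod card_ord -!expnD; congr (2 ^ _)%N.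
    by rewrite -mulnn; clear; lia.
  rewrite -[leLHS]mulr_natl natrX.
  apply: (@le_trans _ _ (expR 1 ^+ (3 * n ^ 2) * expR (- (4 * n%:R ^+ 2)))).
    rewrite ler_wpM2r ?expR_ge0 //; apply: lerXn2r; rewrite ?nnegrE ?expR_ge0 //.
    exact: expR_ge1Dx.
  rewrite -expRM_natl -expRD natrM natrX mulr1.
  have -> : 3 * n%:R ^+ 2 + - (4 * n%:R ^+ 2) = - n%:R ^+ 2 :> R by ring.
  rewrite expRN mul1r lef_pV2 ?posrE ?expR_gt0 //.
  apply: le_trans (expR_ge1Dx _); rewrite (@le_trans _ _ (n%:R ^+ 2)) ?lerDr //.
  by rewrite expr2 ler_peMl // ler1n ltnW.
have cardU (A B : {set {ffun 'I_d -> latin n}}) : #|A :|: B|%:R <= #|A|%:R + #|B|%:R :> R.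
  by rewrite -natrD ler_nat leq_card_setU.
apply: le_trans (cardU _ _) _; apply: le_trans (lerD (cardU _ _) Ul) _.
apply: le_trans (lerD (lerD (cardU _ _) Uc) (lexx _)) _.
apply: le_trans (lerD (lerD (lerD Ua Ub) (lexx _)) (lexx _)) _.
by move: (_ ^+ d) (n%:R^-1) => x y; clear; lra.
Qed.
End Probability.

(** * From bit matrices to cochains of the complex *)

Lemma F2_addb (x y : 'F_2) : (x + y != 0) = (x != 0) (+) (y != 0).
Proof. by move: x y; do 2!case=> [[|[|//]] ?]. Qed.

Section Cochains.
Variables (V : finType) (X : scomplex V).

Lemma cochain_atE k (phi : cochain X k) s (sX : s \in faces X k) :
  cochain_at phi s = phi (exist _ s sX).
Proof. by rewrite /cochain_at insubT. Qed.

Lemma cochain_atD k (phi chi : cochain X k) s :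
  cochain_at (phi + chi) s = cochain_at phi s + cochain_at chi s.
Proof. by rewrite /cochain_at; case: insubP => [u _ _|_]; rewrite ?ffunE ?addr0. Qed.

Lemma cochain_at_cobound k (phi : cochain X k) s : s \in faces X k.+1 ->
  cochain_at (cobound phi) s = \sum_(v in s) cochain_at phi (s :\ v).
Proof. by move=> sX; rewrite cochain_atE ffunE. Qed.

Lemma coboundD k (phi chi : cochain X k) : cobound (phi + chi) = cobound phi + cobound chi.
Proof.
apply/ffunP => s; rewrite !ffunE -big_split /=; apply: eq_bigr => v _.
exact: cochain_atD.
Qed.

Lemma sum_edge (phi : {set V} -> 'F_2) u v : u != v ->
  \sum_(x in [set u; v]) phi ([set u; v] :\ x) = phi [set v] + phi [set u].
Proof.
move=> uv; rewrite big_setU1 ?inE //= big_set1; congr (phi _ + phi _).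
  by apply/setP => x; rewrite !inE; case: (eqVneq x u) => //= ->; rewrite (negbTE uv).
by apply/setP => x; rewrite !inE; case: (eqVneq x v) => [->|]; rewrite ?orbF // [v == u]eq_sym (negbTE uv).
Qed.

Lemma sum_triangle (phi : {set V} -> 'F_2) u v w : u != v -> v != w -> u != w ->
  \sum_(x in [set u; v; w]) phi ([set u; v; w] :\ x) =
  phi [set v; w] + phi [set u; w] + phi [set u; v].
Proof.
move=> uv vw uw; rewrite -setUA big_setU1 ?inE ?negb_or ?uv //=.
rewrite big_setU1 ?inE //= big_set1 addrA; congr (phi _ + phi _ + phi _);
  apply/setP => x; rewrite !inE.
- by case: (eqVneq x u) => //= ->; rewrite (negbTE uv) (negbTE uw).
- by case: (eqVneq x v) => [->|]; rewrite ?orbF // [v == u]eq_sym (negbTE uv) (negbTE vw).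
- by case: (eqVneq x w) => [->|]; rewrite ?orbF // ![w == _]eq_sym (negbTE uw) (negbTE vw).
Qed.

Lemma cnormE k (phi : cochain X k) :
  cnorm phi = #|[set s in faces X k | cochain_at phi s != 0]|.
Proof.
rewrite /cnorm -(card_imset _ val_inj); apply: eq_card => s.
apply/imsetP/setIdP => [[[t tX] + ->]|[sX s0]].
  by rewrite inE /= => t0; split=> //; rewrite cochain_atE.
by exists (exist _ s sX); rewrite // inE -cochain_atE.
Qed.
End Cochains.

Section Bridge.
Variables (n d : nat) (Ls : {ffun 'I_d -> latin n}).
Hypothesis d_gt0 : (0 < d)%N.
Local Notation X := (Yunion Ls).

Lemma Y_tripartite s : s \in simplices X -> s \in tripartite_set n.
Proof.
case/bigcupP => k _; case/setUP => [/setIdP[]//|/imset2P[i j _ _ ->]].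
exact: triangle_T.
Qed.

Lemma tripartite_Y s : s \in tripartite_set n -> (#|s| <= 2)%N -> s \in simplices X.
Proof.
move=> sT s2; apply/bigcupP; exists (Ordinal d_gt0) => //.
by apply/setUP; left; apply/setIdP.
Qed.

Lemma triangle_faces k i j : triangle (Ls k) i j \in faces X 2.
Proof.
apply/setIdP; split.
  by apply/bigcupP; exists k => //; apply/setUP; right; apply/imset2P; exists i j.
by rewrite /triangle -setUA cardsU1 cards2 !inE.
Qed.

Definition edge (t : 'I_n * 'I_n + 'I_n * 'I_n + 'I_n * 'I_n) : {set vertex n} :=
  match t with
  | inl (inl e) => [set va e.1; vb e.2]
  | inl (inr e) => [set vb e.1; vc e.2]
  | inr e => [set va e.1; vc e.2]
  end.

Lemma card_color (s : {set vertex n}) : s \in tripartite_set n ->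
  forall u v, u \in s -> v \in s ->
  (match u, v with
   | inl (inl i), inl (inl j) => i == j
   | inl (inr i), inl (inr j) => i == j
   | inr i, inr j => i == j
   | _, _ => true end).
Proof.
rewrite inE => /and3P[/card_le1_eqP s1 /card_le1_eqP s2 /card_le1_eqP s3] [[i|i]|i] [[j|j]|j] // us vs.
- by have [-> //] : va i = va j by apply: s1; rewrite inE ?us ?vs imset_f.
- by have [-> //] : vb i = vb j by apply: s2; rewrite inE ?us ?vs imset_f.
- by have [-> //] : vc i = vc j by apply: s3; rewrite inE ?us ?vs imset_f.
Qed.

Lemma edge_tripartite t : edge t \in tripartite_set n.
Proof.
have sub1 (A : {set vertex n}) x : A \subset [set x] -> (#|A| <= 1)%N.
  by move/subset_leq_card; rewrite cards1.
rewrite inE; case: t => [[[i j]|[i j]]|[i j]] /=; apply/and3P; split;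
  [apply: (sub1 _ (va i))|apply: (sub1 _ (vb j))|apply: (sub1 _ (vb j))
  |apply: (sub1 _ (vb i))|apply: (sub1 _ (vb i))|apply: (sub1 _ (vc j))
  |apply: (sub1 _ (va i))|apply: (sub1 _ (va i))|apply: (sub1 _ (vc j))];
  apply/subsetP => x /setIP[xt /imsetP[y _ ex]]; move: xt; rewrite ex !inE;
  by case/orP => //; rewrite ?eqxx.
Qed.

Lemma set2_eq (T : finType) (a b c e : T) : [set a; b] = [set c; e] ->
  (a = c \/ a = e) /\ (b = c \/ b = e).
Proof. by move=> ab; split; apply/set2P; rewrite -ab ?set21 ?set22. Qed.

Lemma edge_inj : injective edge.
Proof.
by move=> [[[i j]|[i j]]|[i j]] [[[k l]|[k l]]|[k l]] /= /set2_eq[[] // [->] [] // [->]].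
Qed.

Lemma edge_faces t : edge t \in faces X 1.
Proof.
apply/setIdP; split; last by case: t => [[e|e]|e]; rewrite cards2.
by apply: tripartite_Y; [apply: edge_tripartite|case: t => [[e|e]|e]; rewrite cards2].
Qed.

Lemma faces_edge s : s \in faces X 1 -> exists t, s = edge t.
Proof.
case/setIdP => /Y_tripartite sT /cards2P[u [v [uv sE]]].
have [us vs] : u \in s /\ v \in s by rewrite sE !inE !eqxx orbT.
have := card_color sT us vs; move: uv; rewrite sE.
case: u v {us vs sE} => [[i|i]|i] [[j|j]|j].
- by move=> /negP ij /eqP e; case: ij; rewrite e.
- by exists (inl (inl (i, j))).
- by exists (inr (i, j)).
- by exists (inl (inl (j, i))); rewrite setUC.
- by move=> /negP ij /eqP e; case: ij; rewrite e.
- by exists (inl (inr (i, j))).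
- by exists (inr (j, i)); rewrite setUC.
- by exists (inl (inr (j, i))); rewrite setUC.
- by move=> /negP ij /eqP e; case: ij; rewrite e.
Qed.

Lemma vertex_faces (v : vertex n) : [set v] \in faces X 0.
Proof.
have vT : [set v] \in tripartite_set n.
  by rewrite inE; apply/and3P; split; rewrite -(cards1 v) subset_leq_card // subsetIl.
by apply/setIdP; rewrite cards1; split=> //; apply: tripartite_Y; rewrite ?cards1.
Qed.

Definition to_cochain3 (phi : cochain X 1) : cochain3 n :=
  ([ffun e => cochain_at phi (edge (inl (inl e))) != 0],
   [ffun e => cochain_at phi (edge (inl (inr e))) != 0],
   [ffun e => cochain_at phi (edge (inr e)) != 0]).

Lemma weight_to_cochain3 phi : weight (to_cochain3 phi) = cnorm phi.
Proof.
have -> : cnorm phi = #|[set t | cochain_at phi (edge t) != 0]|.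
  rewrite cnormE -(card_imset _ edge_inj); apply: eq_card => s.
  apply/setIdP/imsetP => [[sX s0]|[t + ->]].
    by have [t st] := faces_edge sX; exists t => //; rewrite inE -st.
  by rewrite inE edge_faces.
rewrite -sum1_card big_mkcond /= !big_sumType /weight !pair_big /=.
congr (_ + _ + _)%N; apply: eq_bigr => -[i j] _; rewrite inE ffunE /=;
by case: (_ != 0).
Qed.

Lemma to_cochain3_shift (phi : cochain X 1) (psi : cochain X 0) :
  to_cochain3 (phi + cobound psi) =
  shift (fun i => cochain_at psi [set va i] != 0) (fun j => cochain_at psi [set vb j] != 0)
    (fun k => cochain_at psi [set vc k] != 0) (to_cochain3 phi).
Proof.
congr (_, _, _); apply/ffunP => -[i j]; rewrite !ffunE cochain_atD F2_addb -!addbA; congr (_ (+) _);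
rewrite cochain_at_cobound ?edge_faces // sum_edge // F2_addb addbC //.
Qed.

Lemma shift_ext (ga gb gc ga' gb' gc' : 'I_n -> bool) f :
  ga =1 ga' -> gb =1 gb' -> gc =1 gc' -> shift ga gb gc f = shift ga' gb' gc' f.
Proof.
by move=> ea eb ec; congr (_, _, _); apply/ffunP => e; rewrite !ffunE ?ea ?eb ?ec.
Qed.

Lemma triangles_le_cnorm (phi : cochain X 1) k :
  (triangles (to_cochain3 phi) Ls k <= cnorm (cobound phi))%N.
Proof.
rewrite cnormE /triangles pair_big /=.
have tri_inj : injective (fun e : 'I_n * 'I_n => triangle (Ls k) e.1 e.2).
  move=> [i j] [i' j'] /= /setP e.
  have := e (va i); have := e (vb j); rewrite !inE !eqxx /= => /esym + /esym.
  by rewrite !orbF => /eqP[->] /eqP[->].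
have -> : (\sum_(e : 'I_n * 'I_n) cobd (to_cochain3 phi) e.1 e.2 (val (Ls k) e.1 e.2) =
    #|[set e : 'I_n * 'I_n | cobd (to_cochain3 phi) e.1 e.2 (val (Ls k) e.1 e.2)]|)%N.
  rewrite -sum1_card [RHS]big_mkcond; apply: eq_bigr => e _; rewrite inE.
  by case: (cobd _ _ _ _).
rewrite -(card_imset _ tri_inj); apply/subset_leq_card/subsetP => _ /imsetP[[i j] + ->].
rewrite !inE /= => ct; have tF := triangle_faces k i j.
have /setIdP[tX tc] := tF; rewrite tX tc /= cochain_at_cobound // sum_triangle //.
move: ct; rewrite /cobd /to_cochain3 /ab /bc /ac /= !ffunE !F2_addb /=.
by rewrite -addbA addbC.
Qed.

Lemma cobd_shift ga gb gc (f : cochain3 n) i j k : cobd (shift ga gb gc f) i j k = cobd f i j k.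
Proof.
rewrite /cobd /shift /ab /bc /ac /= !ffunE /=.
by case: (f.1.1 _) (f.1.2 _) (f.2 _) (ga i) (gb j) (gc k) => [] [] [] [] [] [].
Qed.
End Bridge.

(** * The expansion constant and the limit *)

Lemma class_normP (V : finType) (X : scomplex V) (phi : cochain X 1) :
  exists psi : cochain X 0, Defs.class_norm phi = cnorm (phi + cobound psi)%R /\
    forall psi' : cochain X 0,
      (cnorm (phi + cobound psi)%R <= cnorm (phi + cobound psi')%R)%N.
Proof.
rewrite /Defs.class_norm; case: arg_minnP => // psi _ H; exists psi; split=> // psi'.
exact: H.
Qed.

Lemma expanding_h1 (R : realType) (eps : R) (n d : nat) (Ls : {ffun 'I_d -> latin n}) :
  (0 < d)%N -> expanding eps Ls -> (eps%:E < h1 R (Yunion Ls))%E.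
Proof.
move=> d0 exp_Ls; rewrite /h1; elim/big_ind: _ => [|x y ex ey|phi phiB].
- exact: ltry.
- by rewrite lt_min ex ey.
have [psi [cE psi_min]] := class_normP phi.
pose f := to_cochain3 (phi + cobound psi).
have wf : weight f = Defs.class_norm phi by rewrite weight_to_cochain3 // cE.
have fmin : minimal f.
  move=> ga gb gc; rewrite wf cE.
  pose g (v : vertex n) : 'F_2 := match v with
    | inl (inl i) => (ga i)%:R | inl (inr j) => (gb j)%:R | inr k => (gc k)%:R end.
  pose chi : cochain (Yunion Ls) 0 := 
    [ffun s : {s : {set vertex n} | s \in faces (Yunion Ls) 0} => \sum_(v in sval s) g v].
  have chiE v : cochain_at chi [set v]%SET = g v.
    by rewrite (cochain_atE _ (vertex_faces Ls d0 v)) ffunE /= big_set1.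
  have F2b (b : bool) : ((b%:R : 'F_2) != 0) = b by case: b.
  have -> : shift ga gb gc f = to_cochain3 (phi + cobound psi + cobound chi).
    by rewrite to_cochain3_shift //; apply: shift_ext => i; rewrite chiE F2b.
  by rewrite weight_to_cochain3 // -addrA -coboundD.
have w0 : (0 < weight f)%N.
  (* Weight 0 would mean that [phi + cobound psi] vanishes, so [phi] equals [cobound psi] in
     characteristic 2. *)
  rewrite lt0n; apply: contra phiB; rewrite wf cE cards_eq0 => /eqP s0.
  apply/imsetP; exists psi => //.
  apply/ffunP => s; have := congr1 (fun A : {set _} => s \in A) s0.
  rewrite !inE ffunE => /negbFE/eqP.
  have F2N (x y : 'F_2) : x + y = 0 -> x = y.
    by move: x y; do 2!case=> [[|[|//]] ?] //; move=> _; apply: val_inj.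
  exact: F2N.
have [k Hk] := exp_Ls f fmin w0.
rewrite lte_fin ltr_pdivlMr -wf ?ltr0n //; apply: lt_le_trans Hk _.
rewrite ler_nat.
have -> : triangles f Ls k = triangles (to_cochain3 phi) Ls k.
  rewrite /f to_cochain3_shift //; apply: eq_bigr => i _; apply: eq_bigr => j _.
  by rewrite cobd_shift.
exact: triangles_le_cnorm.
Qed.

Lemma Pr_unif_bounds (R : realType) (S : finType) (d : nat)
    (E : pred {ffun 'I_d -> S}) (B : {set {ffun 'I_d -> S}}) (delta : R) :
  (0 < #|S|)%N -> #|B|%:R <= #|S|%:R ^+ d * delta ->
  (forall t, t \notin B -> E t) -> 1 - delta <= Pr_unif R E <= 1.
Proof.
move=> S0 Bd BE; have SR : 0 < #|S|%:R ^+ d :> R by rewrite exprn_gt0 // ltr0n.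
have -> : Pr_unif R E = #|E|%:R / #|S|%:R ^+ d.
  rewrite /Pr_unif (eq_bigr (fun=> (#|S|%:R ^+ d)^-1)) => [|t _].
    by rewrite sumr_const mulr_natl.
  by rewrite prodr_const card_ord exprVn.
have cardT : #|{ffun 'I_d -> S}| = (#|S| ^ d)%N by rewrite card_ffun card_ord.
apply/andP; split; last first.
  by rewrite ler_pdivrMr // mul1r -natrX ler_nat -cardT max_card.
rewrite ler_pdivlMr // mulrBl mul1r mulrC lerBlDr; apply: le_trans (lerD (lexx _) Bd).
rewrite -natrX -natrD ler_nat -cardT -(cardC (mem B)) addnC leq_add2r.
by apply/subset_leq_card/fintype.subsetP => t tB; apply: BE.
Qed.

Local Open Scope classical_set_scope.

Theorem theorem1 (R : realType) :
  exists (eps : R) (d : nat), [/\ 0 < eps, (0 < d)%N &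
    (fun n : nat => Pr_unif R
       (fun Ls : {ffun 'I_d -> latin n} => (eps%:E < h1 R (Yunion Ls))%E))
      @ \oo --> (1 : R)].
Proof.
have [eps [d [N [eps0 d0 whp]]]] := expanding_whp R.
exists eps, d; split => //; apply/cvgrPdist_le => e e0.
exists (maxn N (Num.bound (7 / e)).+1) => // n /=; rewrite geq_max => /andP[Nn en].
have n0 : (0 < n)%N by apply: leq_trans en.
have nR : 0 < n%:R :> R by rewrite ltr0n.
(* The lower bound for the number of squares also yields that one exists, so that the uniform
   distribution makes sense. *)
have lat0 : (0 < #|latin n|)%N.
  have := card_latin_ge n; rewrite lt0n; apply: contraTneq => ->.
  by rewrite muln0 -ltnNge expn_gt0 fact_gt0.
have [B [HB Bexp]] := whp n Nn.
have /andP[lo hi] := Pr_unif_bounds (E := fun Ls : {ffun 'I_d -> latin n} => (eps%:E < h1 R (Yunion Ls))%E)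
  lat0 HB (fun Ls LsB => expanding_h1 d0 (Bexp Ls LsB)).
rewrite ger0_norm ?subr_ge0 // lerBlDr -lerBlDl; apply: le_trans lo.
rewrite lerD2l lerN2 ler_pdivrMr // mulrC -ler_pdivrMr //.
by rewrite ltW // (lt_le_trans (archi_boundP _)) ?divr_ge0 ?(ltW e0) // ler_nat ltnW.
Qed.
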